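(* There are isomorphisms of $\mathcal{R}$-algebras $$\widehat{Y}_{r,n}\cong \widehat{E}_{r,n}^{\mathcal{R}}\cong\bigoplus_{\lambda\in\underline{\mathfrak{s}}_n'}\mathrm{Mat}_{n_\lambda}(\widehat{H}_\lambda^{\mathcal{R}}),$$ where $n_\lambda=|\mathfrak{S}_n\lambda|$ and $\mathrm{Mat}_{m}(R)$ denotes the algebra of $m\times m$ matrices over $R$.
   Context: Let $r,n\ge1$, $\zeta=e^{2\pi i/r}$, $\zeta_k:=\zeta^{k-1}$, $q$ an indeterminate, $\mathcal{R}=\mathbb{Z}[\frac1r][q,q^{-1},\zeta]$, $\mathcal{A}=\mathbb{Z}[q,q^{-1}]$, $s_i=(i,i+1)$, $W=\mathfrak{S}_n$. The affine Yokonuma–Hecke algebra $\widehat{Y}_{r,n}$ is the $\mathcal{R}$-algebra generated by $t_1,\dots,t_n,h_1,\dots,h_{n-1},Y_1^{\pm1}$ with relations: $h_ih_j=h_jh_i$ ($|i-j|\ge2$); $h_ih_{i+1}h_i=h_{i+1}h_ih_{i+1}$; $t_it_j=t_jt_i$; $h_it_j=t_{s_i(j)}h_i$; $t_i^r=1$; $h_i^2=1+(q-q^{-1})e_ih_i$ with $e_i=\frac1r\sum_{s=0}^{r-1}t_i^st_{i+1}^{-s}$; $Y_1Y_1^{-1}=Y_1^{-1}Y_1=1$; $h_1Y_1h_1Y_1=Y_1h_1Y_1h_1$; $h_iY_1=Y_1h_i$ ($2\le i\le n-1$); $t_jY_1=Y_1t_j$. Let $\underline{\mathfrak{s}}_n$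 be the set of $n$-tuples of $r$-th roots of unity, $W$ permuting entries, $W_\lambda$ the stabilizer. $\widehat{H}_{r,n}$ is the $\mathcal{A}$-algebra generated by $g_1,\dots,g_{n-1}$, $1_\lambda$ ($\lambda\in\underline{\mathfrak{s}}_n$), $X_1^{\pm1}$ with relations: $g_ig_j=g_jg_i$ ($|i-j|\ge2$); $g_ig_{i+1}g_i=g_{i+1}g_ig_{i+1}$; $g_i1_\lambda=1_{s_i(\lambda)}g_i$; $\sum_\lambda1_\lambda=1$; $1_\lambda1_{\lambda'}=\delta_{\lambda,\lambda'}1_\lambda$; $g_i^2=1+(q-q^{-1})\sum_{\lambda:\,s_i\in W_\lambda}g_i1_\lambda$; $X_1X_1^{-1}=X_1^{-1}X_1=1$; $g_1X_1g_1X_1=X_1g_1X_1g_1$; $g_iX_1=X_1g_i$ ($2\le i\le n-1$); $X_11_\lambda=1_\lambda X_1$. For $\lambda\in\underline{\mathfrak{s}}_n$ let $\lambda^0$ be the unique element of $W\lambda$ of the form $(\zeta_1^{\times n_1},\dots,\zeta_r^{\times n_r})$; $\underline{\mathfrak{s}}_n'$ is the set of all such $\lambda^0$. $\Gamma=\{(\lambda_1,\lambda_2)\mid W\lambda_1=W\lambda_2\}$; $\widehat{E}_{r,n}$ is the $\mathcal{A}$-algebra of formal sums $x=\sum_{(\lambda_1,\lambda_2)\in\Gamma}x_{\lambda_1,\lambda_2}$, $x_{\lambda_1,\lambda_2}\in1_{\lambda_1^0}\widehat{H}_{r,n}1_{\lambda_2^0}$, with product $(xy)_{\lambda_1,\lambda_2}=\sum_{\tilde\lambda\in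 W\lambda_1}x_{\lambda_1,\tilde\lambda}y_{\tilde\lambda,\lambda_2}$; $\widehat{E}_{r,n}^{\mathcal{R}}=\mathcal{R}\otimes_{\mathcal{A}}\widehat{E}_{r,n}$. The extended affine Hecke algebra $\widehat{H}_n$ of type $A$ over $\mathcal{A}$ is generated by $T_1,\dots,T_{n-1},Z_1^{\pm1},\dots,Z_n^{\pm1}$ with braid relations among the $T_i$, $T_i^2=1+(q-q^{-1})T_i$, the $Z_j$ commuting invertible, $T_iZ_j=Z_jT_i$ ($j\neq i,i+1$), $Z_{i+1}=T_iZ_iT_i$. For $\lambda\in\underline{\mathfrak{s}}_n'$ with multiplicities $n_1,\dots,n_r$, $\widehat{H}_\lambda$ is the subalgebra generated by all $Z_j^{\pm1}$ and the $T_i$ with $s_i\in W_\lambda=\mathfrak{S}_{n_1}\times\cdots\times\mathfrak{S}_{n_r}$ (so $\widehat{H}_\lambda\cong\widehat{H}_{n_1}\otimes\cdots\otimes\widehat{H}_{n_r}$), and $\widehat{H}_\lambda^{\mathcal{R}}=\mathcal{R}\otimes_{\mathcal{A}}\widehat{H}_\lambda$. *)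

(* Defs.v *)
From HB Require Import structures.
From mathcomp Require Import all_boot all_order all_algebra all_fingroup.
From mathcomp Require Import cyclotomic.
Set Implicit Arguments. Unset Strict Implicit. Unset Printing Implicit Defensive.
Import GRing.Theory.
Local Open Scope ring_scope.

(* The base ring  R = Z[1/r][q,q^-1,zeta],  zeta = e^{2 pi i/r}, characterised *)
(* by its universal property: it is the commutative ring generated by         *)
(* elements q, qi, z, ri subject to  q*qi = 1, r*ri = 1, Phi_r(z) = 0          *)
(* (i.e. Z[q,q^-1,1/r][x]/(Phi_r) = Z[1/r][zeta][q,q^-1]).                    *)
Definition base_rel (r : nat) (S : comNzRingType) (q qi z ri : S) : Prop :=
  [/\ q * qi = 1, r%:R * ri = 1 & root (map_poly intr ('Phi_r)) z].

Definition is_base_ring (r : nat) (R : comNzRingType) (q qi z ri : R) : Prop :=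
  base_rel r q qi z ri /\
  forall (S : comNzRingType) (q' qi' z' ri' : S), base_rel r q' qi' z' ri' ->
    (exists f : {rmorphism R -> S},
        [/\ f q = q', f qi = qi', f z = z' & f ri = ri']) /\
    (forall f g : {rmorphism R -> S},
        f q = g q -> f qi = g qi -> f z = g z -> f ri = g ri -> f =1 g).

(* Algebras given by generators and relations, via the universal property.   *)
(* G: labels of generators, valid: the labels actually used (indices in       *)
(* range), rel B g: the defining relations for a family g of elements of B.  *)
Definition presents (R : comNzRingType) (G : Type) (valid : G -> bool)
    (rel : forall B : algType R, (G -> B) -> Prop)
    (A : algType R) (gen : G -> A) : Prop :=
  rel A gen /\
  forall (B : algType R) (g : G -> B), rel B g ->
    (exists f : {lrmorphism A -> B}, forall x, valid x -> f (gen x) = g x) /\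
    (forall f1 f2 : {lrmorphism A -> B},
        (forall x, valid x -> f1 (gen x) = f2 (gen x)) -> f1 =1 f2).

(* simple transposition s_i on {1..n} (1-based indices) *)
Definition sw (i j : nat) : nat :=
  if j == i then i.+1 else if j == i.+1 then i else j.

Inductive YG := Yt of nat | Yh of nat | YY | YYi.

Definition Yvalid (n : nat) (x : YG) : bool :=
  match x with
  | Yt i => (1 <= i <= n)%N
  | Yh i => (1 <= i <= n.-1)%N
  | _ => true
  end.

Definition Yrel (r n : nat) (R : comNzRingType) (q qi ri : R)
    (B : algType R) (g : YG -> B) : Prop :=
  let t i := g (Yt i) in let h i := g (Yh i) in
  let Y1 := g YY in let Y1i := g YYi in
  (* t_j^{-1} = t_j^{r-1}, since t_j^r = 1 *)
  let tinv j := t j ^+ r.-1 in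
  let e i := ri *: \sum_(s < r) (t i ^+ s * tinv i.+1 ^+ s) in
  ((forall i j, (1 <= i)%N -> (i.+1 < j)%N -> (j <= n.-1)%N ->
         h i * h j = h j * h i) /\
      (forall i, (1 <= i)%N -> (i.+1 <= n.-1)%N ->
         h i * h i.+1 * h i = h i.+1 * h i * h i.+1) /\
      (forall i j, (1 <= i <= n)%N -> (1 <= j <= n)%N -> t i * t j = t j * t i) /\
      (forall i j, (1 <= i <= n.-1)%N -> (1 <= j <= n)%N ->
         h i * t j = t (sw i j) * h i) /\
      (forall i, (1 <= i <= n)%N -> t i ^+ r = 1) /\
      (forall i, (1 <= i <= n.-1)%N -> h i ^+ 2 = 1 + (q - qi) *: (e i * h i)) /\
      (Y1 * Y1i = 1 /\ Y1i * Y1 = 1) /\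
      ((1 < n)%N -> h 1%N * Y1 * h 1%N * Y1 = Y1 * h 1%N * Y1 * h 1%N) /\
      (forall i, (2 <= i <= n.-1)%N -> h i * Y1 = Y1 * h i) /\
      (forall j, (1 <= j <= n)%N -> t j * Y1 = Y1 * t j)).

(* n-tuples of r-th roots of unity: lambda = (zeta^{k_1},...,zeta^{k_n}) is   *)
(* encoded by the exponents  k : {ffun 'I_n -> 'I_r}  (zeta_k = zeta^{k-1}).  *)
Definition Lam (n r : nat) := {ffun 'I_n -> 'I_r}.

(* s_i . lambda (1-based i): entries at positions i and i+1 swapped *)
Definition swl (n r : nat) (i : nat) (l : Lam n r) : Lam n r :=
  [ffun p : 'I_n => l (insubd p (sw i p.+1).-1)].

Definition orbW (n r : nat) (l : Lam n r) : {set Lam n r} :=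
  [set [ffun j => l (s j)] | s : {perm 'I_n}].

(* lambda is of the form (zeta_1^{n_1},...,zeta_r^{n_r}), i.e. in s'_n *)
Definition dominant (n r : nat) (l : Lam n r) : bool :=
  [forall i : 'I_n, forall j : 'I_n, (i <= j)%N ==> (l i <= l j)%N].

(* lambda^0 : the unique element of W lambda in s'_n *)
Definition lam0 (n r : nat) (l : Lam n r) : Lam n r :=
  odflt l [pick m in orbW l | dominant m].

Definition nl (n r : nat) (l : Lam n r) : nat := #|orbW l|.

Inductive HG (n r : nat) := Hg of nat | He of Lam n r | HX | HXi.

Definition Hvalid (n r : nat) (x : HG n r) : bool :=
  match x with
  | Hg i => (1 <= i <= n.-1)%N
  | _ => true
  end.

Definition Hrel (n r : nat) (R : comNzRingType) (q qi : R)
    (B : algType R) (gg : HG n r -> B) : Prop :=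
  let g i := gg (Hg n r i) in let e l := gg (He l) in
  let X1 := gg (HX n r) in let X1i := gg (HXi n r) in
  ((forall i j, (1 <= i)%N -> (i.+1 < j)%N -> (j <= n.-1)%N ->
         g i * g j = g j * g i) /\
      (forall i, (1 <= i)%N -> (i.+1 <= n.-1)%N ->
         g i * g i.+1 * g i = g i.+1 * g i * g i.+1) /\
      (forall i l, (1 <= i <= n.-1)%N -> g i * e l = e (swl i l) * g i) /\
      \sum_(l : Lam n r) e l = 1 /\
      (forall l l', e l * e l' = if l == l' then e l else 0) /\
      (forall i, (1 <= i <= n.-1)%N ->
         g i ^+ 2 = 1 + (q - qi) *: \sum_(l : Lam n r | swl i l == l) g i * e l) /\
      (X1 * X1i = 1 /\ X1i * X1 = 1) /\
      ((1 < n)%N -> g 1%N * X1 * g 1%N * X1 = X1 * g 1%N * X1 * g 1%N) /\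
      (forall i, (2 <= i <= n.-1)%N -> g i * X1 = X1 * g i) /\
      (forall l, X1 * e l = e l * X1)).

(* \hat E_{r,n}^R built from H = \hat H_{r,n}^R: formal sums over Gamma,       *)
(* represented as functions on pairs (lambda_1, lambda_2).                   *)
Section E.
Variables (n r : nat) (R : comNzRingType) (H : algType R) (e : Lam n r -> H).

Definition Eset (x : {ffun Lam n r * Lam n r -> H}) : Prop :=
  forall l1 l2 : Lam n r,
    (l2 \notin orbW l1 -> x (l1, l2) = 0) /\
    (l2 \in orbW l1 -> exists h : H, x (l1, l2) = e (lam0 l1) * h * e (lam0 l2)).

Definition Elin (a : R) (x y : {ffun Lam n r * Lam n r -> H})
  : {ffun Lam n r * Lam n r -> H} := [ffun p => a *: x p + y p].

Definition Emul (x y : {ffun Lam n r * Lam n r -> H})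
  : {ffun Lam n r * Lam n r -> H} :=
  [ffun p => \sum_(m in orbW p.1) x (p.1, m) * y (m, p.2)].

Definition Eone : {ffun Lam n r * Lam n r -> H} :=
  [ffun p => if p.1 == p.2 then e (lam0 p.1) else 0].
End E.

Inductive AG := AT of nat | AZ of nat | AZi of nat.

Definition Avalid (n : nat) (x : AG) : bool :=
  match x with
  | AT i => (1 <= i <= n.-1)%N
  | AZ j => (1 <= j <= n)%N
  | AZi j => (1 <= j <= n)%N
  end.

Definition Arel (n : nat) (R : comNzRingType) (q qi : R)
    (B : algType R) (gg : AG -> B) : Prop :=
  let T i := gg (AT i) in let Z j := gg (AZ j) in let Zi j := gg (AZi j) in
  ((forall i j, (1 <= i)%N -> (i.+1 < j)%N -> (j <= n.-1)%N ->
         T i * T j = T j * T i) /\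
      (forall i, (1 <= i)%N -> (i.+1 <= n.-1)%N ->
         T i * T i.+1 * T i = T i.+1 * T i * T i.+1) /\
      (forall i, (1 <= i <= n.-1)%N -> T i ^+ 2 = 1 + (q - qi) *: T i) /\
      (forall j k, (1 <= j <= n)%N -> (1 <= k <= n)%N -> Z j * Z k = Z k * Z j) /\
      (forall j, (1 <= j <= n)%N -> Z j * Zi j = 1 /\ Zi j * Z j = 1) /\
      (forall i j, (1 <= i <= n.-1)%N -> (1 <= j <= n)%N -> j != i -> j != i.+1 ->
         T i * Z j = Z j * T i) /\
      (forall i, (1 <= i <= n.-1)%N -> Z i.+1 = T i * Z i * T i)).

Definition in_subalg (R : comNzRingType) (A : algType R) (S : A -> Prop) (x : A)
  : Prop :=
  forall P : A -> Prop,
    P 1 ->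
    (forall (a : R) u v, P u -> P v -> P (a *: u + v)) ->
    (forall u v, P u -> P v -> P (u * v)) ->
    (forall s, S s -> P s) -> P x.

Definition Hlam_gen (n r : nat) (R : comNzRingType) (A : algType R)
    (gg : AG -> A) (l : Lam n r) (x : A) : Prop :=
  (exists j, (1 <= j <= n)%N /\ (x = gg (AZ j) \/ x = gg (AZi j))) \/
  (exists i, [/\ (1 <= i <= n.-1)%N, swl i l == l & x = gg (AT i)]).

Definition in_Hlam (n r : nat) (R : comNzRingType) (A : algType R)
    (gg : AG -> A) (l : Lam n r) (x : A) : Prop :=
  in_subalg (Hlam_gen gg l) x.

(* The direct sum  (+)_{lambda in s'_n} Mat_{n_lambda}(\hat H_lambda^R),      *)
(* as families of matrices indexed by all lambda, zero off s'_n.             *)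
Section DS.
Variables (n r : nat) (R : comNzRingType) (A : algType R) (gg : AG -> A).

Definition DS := forall l : Lam n r, 'M[A]_(nl l).

Definition DSset (M : DS) : Prop :=
  forall l : Lam n r,
    if dominant l then forall i j, in_Hlam gg l (M l i j) else M l = 0.

Definition DSlin (a : R) (M N : DS) : DS :=
  fun l => \matrix_(i, j) (a *: M l i j + N l i j).

Definition DSmul (M N : DS) : DS := fun l => M l *m N l.

Definition DSone : DS := fun l => if dominant l then 1%:M else 0.
End DS.

(* Main.v *)
(* The algebra Y is identified with H by diagonalising the commuting t_j, whose
   joint spectral projections are the idempotents 1_lambda.  Along an orbit the
   g_i 1_mu with s_i mu <> mu are invertible, so H splits into full matrix
   algebras over the corners 1_lambda H 1_lambda with lambda dominant, and the
   point is to identify such a corner with H_lambda.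

   No basis theorem is used.  In one direction, H acts by matrices over the
   affine Hecke algebra: g_i exchanges mu and s_i mu when they differ and acts
   by T_k on mu otherwise, where k is the place to which the stable sorting of
   mu moves the i-th entry, and X_1 acts on mu by Z_k with k the place of the
   first entry.  In the other direction, there is a homomorphism from the affine
   Hecke algebra to H, describing the module induced from H_lambda: it sends T_i to
   g_i + (q - q^-1) sum_(mu_i > mu_(i+1)) 1_mu and is best understood on the
   rotation T_(n-1) ... T_1 Z_1, which goes to g_(n-1) ... g_1 X_1.  Restricted to
   H_lambda and cut by 1_lambda it sends T_i to g_i 1_lambda and Z_j to
   X_j 1_lambda, and hence inverts the matrix coefficient at (lambda, lambda). *)
Require Import Defs.
From HB Require Import structures.
From mathcomp Require Import all_boot all_order all_algebra all_fingroup all_field.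
From mathcomp Require Import zify ring.
From mathcomp Require boolp.
Set Implicit Arguments. Unset Strict Implicit. Unset Printing Implicit Defensive.
Import GRing.Theory.
Local Open Scope ring_scope.

(** * Matrix algebras and generation by generators *)

(** The obstacle is that each algebra is known only through its presentation, so injectivity cannot
    be read off from a basis. It is replaced by an identity checked on generators: the block
    [e m * x * e l] equals [gamma m * theta (rho x (m, l)) * gamma' l], where [rho] is the matrix
    representation, [theta] the homomorphism out of the affine Hecke algebra, and [gamma l] the
    product of the g_i along a sorting of l. One matrix entry thus determines a whole block.
    Together with [rho (theta h * e l) (l, l) = h] on H_l, also checked on generators, this makes
    the two maps mutually inverse. The correction in the image of T_i is forced: g_i squares to 1
    between distinct tuples, while T_i obeys the same quadratic relation everywhere. It destroys
    compatibility with the idempotents and complicates the image of Z_1. The rotation escapes this,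
    since it shifts entries cyclically and so only relabels the descents away from the wrap-around.
    Stability of the sorting keeps equal neighbours adjacent, so that a single T_k can act on
    them. *)

(* ['M[A]_n] is an algebra over A, not over R; [i0] makes it a nonzero ring, as [algType] demands. *)
Definition ffmx (R : comNzRingType) (A : algType R) (I : finType) (i0 : I) :=
  {ffun I * I -> A}.

Section MatrixAlgebra.
Variables (R : comNzRingType) (A : algType R) (I : finType) (i0 : I).
Local Notation M := (ffmx A i0).

HB.instance Definition _ := GRing.Zmodule.on M.

Definition ffmx_one : M := [ffun p => (p.1 == p.2)%:R].
Definition ffmx_mul (x y : M) : M := [ffun p => \sum_k x (p.1, k) * y (k, p.2)].
Definition ffmx_scale (a : R) (x : M) : M := [ffun p => a *: x p].

Lemma ffmx_mulA : associative ffmx_mul.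
Proof.
move=> x y w; apply/ffunP=> -[i j]; rewrite !ffunE /=.
under eq_bigr => k _ do rewrite ffunE mulr_sumr.
rewrite exchange_big /=; apply: eq_bigr => k _; rewrite ffunE mulr_suml.
by apply: eq_bigr => l _; rewrite mulrA.
Qed.

Lemma ffmx_mul1l : left_id ffmx_one ffmx_mul.
Proof.
move=> x; apply/ffunP=> -[i j]; rewrite ffunE (bigD1 i) //= ffunE eqxx mul1r.
by rewrite big1 ?addr0 // => k ki; rewrite ffunE /= eq_sym (negPf ki) mul0r.
Qed.

Lemma ffmx_mul1r : right_id ffmx_one ffmx_mul.
Proof.
move=> x; apply/ffunP=> -[i j]; rewrite ffunE (bigD1 j) //= ffunE eqxx mulr1.
by rewrite big1 ?addr0 // => k kj; rewrite ffunE /= (negPf kj) mulr0.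
Qed.

Lemma ffmx_mulDl : left_distributive ffmx_mul +%R.
Proof.
move=> x y w; apply/ffunP=> p; rewrite !ffunE -big_split /=.
by apply: eq_bigr => k _; rewrite ffunE mulrDl.
Qed.

Lemma ffmx_mulDr : right_distributive ffmx_mul +%R.
Proof.
move=> x y w; apply/ffunP=> p; rewrite !ffunE -big_split /=.
by apply: eq_bigr => k _; rewrite ffunE mulrDr.
Qed.

Lemma ffmx_one_neq0 : ffmx_one != 0.
Proof.
apply/eqP => /ffunP/(_ (i0, i0))/eqP.
by rewrite !ffunE eqxx oner_eq0.
Qed.

HB.instance Definition _ := GRing.Zmodule_isNzRing.Build M
  ffmx_mulA ffmx_mul1l ffmx_mul1r ffmx_mulDl ffmx_mulDr ffmx_one_neq0.

Lemma ffmx_scaleA a b (x : M) : ffmx_scale a (ffmx_scale b x) = ffmx_scale (a * b) x.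
Proof. by apply/ffunP=> p; rewrite !ffunE scalerA. Qed.

Lemma ffmx_scale1 : left_id 1 ffmx_scale.
Proof. by move=> x; apply/ffunP=> p; rewrite !ffunE scale1r. Qed.

Lemma ffmx_scaleDr : right_distributive ffmx_scale +%R.
Proof. by move=> a x y; apply/ffunP=> p; rewrite !ffunE scalerDr. Qed.

Lemma ffmx_scaleDl x : {morph ffmx_scale^~ x : a b / a + b}.
Proof. by move=> a b; apply/ffunP=> p; rewrite !ffunE scalerDl. Qed.

HB.instance Definition _ := GRing.Zmodule_isLmodule.Build R M
  ffmx_scaleA ffmx_scale1 ffmx_scaleDr ffmx_scaleDl.

Lemma ffmx_scaleAl a (x y : M) : a *: (x * y) = (a *: x) * y.
Proof.
apply/ffunP=> p; rewrite !ffunE scaler_sumr.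
by apply: eq_bigr => k _; rewrite ffunE scalerAl.
Qed.

HB.instance Definition _ := GRing.Lmodule_isLalgebra.Build R M ffmx_scaleAl.

Lemma ffmx_scaleAr a (x y : M) : a *: (x * y) = x * (a *: y).
Proof.
apply/ffunP=> p; rewrite !ffunE scaler_sumr.
by apply: eq_bigr => k _; rewrite ffunE scalerAr.
Qed.

HB.instance Definition _ := GRing.Lalgebra_isAlgebra.Build R M ffmx_scaleAr.

Lemma ffmxM (x y : M) i j : (x * y) (i, j) = \sum_k x (i, k) * y (k, j).
Proof. by rewrite ffunE. Qed.

Lemma ffmx1 i j : (1 : M) (i, j) = (i == j)%:R.
Proof. by rewrite ffunE. Qed.

Lemma ffmxZ a (x : M) p : (a *: x) p = a *: x p.
Proof. by rewrite ffunE. Qed.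

(** Every generator of H acts with at most one nonzero entry per column, so that its relations
    reduce to identities between index maps and between coefficients. *)
Definition monomial (f : I -> I) (a : I -> A) : M :=
  [ffun p => if p.1 == f p.2 then a p.2 else 0].

Lemma monomialM f a g b :
  monomial f a * monomial g b = monomial (f \o g) (fun y => a (g y) * b y).
Proof.
apply/ffunP=> -[i j]; rewrite ffmxM !ffunE /= (bigD1 (g j)) //= !ffunE /= eqxx.
rewrite big1 ?addr0 => [|k kg]; first by case: ifP => // _; rewrite mul0r.
by rewrite !ffunE /= (negPf kg) mulr0.
Qed.

Lemma eq_monomial f a g b : (forall y, f y = g y) -> (forall y, a y = b y) ->
  monomial f a = monomial g b.
Proof. by move=> fg ab; apply/ffunP=> p; rewrite !ffunE fg ab. Qed.

Lemma monomial1 : 1 = monomial id (fun=> 1).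
Proof. by apply/ffunP=> -[i j]; rewrite ffmx1 ffunE /=; case: (_ == _). Qed.

Lemma monomial_id_sum (f : I -> I) (a : I -> I -> A) :
  \sum_k monomial f (a k) = monomial f (fun y => \sum_k a k y).
Proof.
apply/ffunP=> p; rewrite sum_ffunE [RHS]ffunE.
case: ifP => e; first by apply: eq_bigr => k _; rewrite ffunE e.
by apply: big1 => k _; rewrite ffunE e.
Qed.

End MatrixAlgebra.

Section Generation.
Variables (R : comNzRingType) (A : algType R) (P : A -> Prop).
Hypotheses (P1 : P 1) (Plin : forall a u v, P u -> P v -> P (a *: u + v)).
Hypothesis PM : forall u v, P u -> P v -> P (u * v).

Definition subalg_mem : {pred A} := fun x => boolp.asbool (P x).

Lemma subalg_memP x : reflect (P x) (x \in subalg_mem).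
Proof. exact: boolp.asboolP. Qed.

Lemma subalg_mem_closed : subalg_closed subalg_mem.
Proof.
split=> [|a u v /subalg_memP Pu /subalg_memP Pv|u v /subalg_memP Pu /subalg_memP Pv];
  by apply/subalg_memP; auto.
Qed.

HB.instance Definition _ := GRing.isSubalgClosed.Build R A subalg_mem subalg_mem_closed.

Record subalg := Subalg { subalg_val : A; subalg_valP : subalg_val \in subalg_mem }.
HB.instance Definition _ := [isSub for subalg_val].
HB.instance Definition _ := [Choice of subalg by <:].
HB.instance Definition _ := [SubChoice_isSubAlgebra of subalg by <:].

HB.instance Definition _ := GRing.RMorphism.on (\val : subalg -> A).

(** The elements satisfying [P] form a subalgebra. It receives a homomorphism from [A], whose
    composite with the inclusion fixes the generators and is the identity by uniqueness. Since [rel]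
    is an arbitrary predicate, its descent along injective homomorphisms has to be assumed. *)
Lemma presents_ind (G : Type) (valid : G -> bool)
    (rel : forall B : algType R, (G -> B) -> Prop) (gen : G -> A) :
  presents valid rel gen ->
  (forall (B : algType R) (f : {lrmorphism B -> A}) (g : G -> B), injective f ->
     (forall x, valid x -> f (g x) = gen x) -> rel B g) ->
  (forall x, valid x -> P (gen x)) -> forall x, P x.
Proof.
move=> [relA univ] rel_sub Pgen x.
pose valm : {lrmorphism subalg -> A} := (\val : subalg -> A).
(* The default 0 is never met at a valid generator. *)
pose g y : subalg := if boolp.pselect (gen y \in subalg_mem) is left h
                     then Subalg h else 0.
have gK y : valid y -> val (g y) = gen y.
  by move=> /Pgen/subalg_memP h; rewrite /g; case: boolp.pselect.
have [[f fg] _] := univ subalg g (rel_sub _ valm _ val_inj gK).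
have [_ /(_ (valm \o f : {lrmorphism A -> A}) (idfun : {lrmorphism A -> A}))] :=
  univ A gen relA.
move=> /(_ _ x)/= <-; first exact/subalg_memP/subalg_valP.
by move=> y vy; rewrite /= fg // gK.
Qed.

End Generation.

(** * Tuples of exponents and stable sorting *)

Section Tuples.
Variables (n r : nat).
Implicit Types (l m : Lam n r) (i j k : nat).
Local Open Scope nat_scope.

(* The entries are numbered from 1; outside 1..n the value 0 is junk. *)
Definition vl l j : nat := if insub j.-1 is Some p then nat_of_ord (l p) else 0.

Lemma vl_ord l (p : 'I_n) : vl l p.+1 = l p.
Proof. by rewrite /vl /= valK. Qed.

Lemma lam_ext l m : (forall j, 0 < j <= n -> vl l j = vl m j) -> l = m.
Proof.
move=> h; apply/ffunP=> p; apply: val_inj.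
by rewrite /= -!vl_ord h //= ltn_ord.
Qed.

Lemma sw_range i j : 0 < i < n -> 0 < j <= n -> 0 < sw i j <= n.
Proof. by rewrite /sw; do 2?case: eqP; lia. Qed.

Lemma swK i : involutive (sw i).
Proof. by move=> j; rewrite /sw; repeat case: eqP; lia. Qed.

Lemma sw_l i : sw i i = i.+1.
Proof. by rewrite /sw eqxx. Qed.

Lemma sw_r i : sw i i.+1 = i.
Proof. by rewrite /sw eqxx; case: eqP; lia. Qed.

Lemma sw_o i j : j != i -> j != i.+1 -> sw i j = j.
Proof. by rewrite /sw => /negPf-> /negPf->. Qed.

Lemma vl_swl i l j : 0 < i < n -> 0 < j <= n -> vl (swl i l) j = vl l (sw i j).
Proof.
move=> hi hj; have hj' : j.-1 < n by lia.
have hs := sw_range hi hj.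
rewrite {1}/vl (insubT (fun k => k < n) hj') ffunE /= prednK; last by lia.
have hs' : (sw i j).-1 < n by lia.
by rewrite /insubd /vl (insubT (fun k => k < n) hs').
Qed.

Lemma swlK i l : 0 < i < n -> swl i (swl i l) = l.
Proof.
move=> hi; apply: lam_ext => j hj.
by rewrite !vl_swl ?swK // sw_range.
Qed.

Lemma swl_comm i j l : 0 < i < n -> 0 < j < n -> i.+1 < j ->
  swl i (swl j l) = swl j (swl i l).
Proof.
move=> hi hj ij; apply: lam_ext => k hk.
rewrite !vl_swl ?sw_range //; congr (vl l _).
by rewrite /sw; repeat case: eqP; lia.
Qed.

Lemma swl_braid i l : 0 < i < n -> 0 < i.+1 < n ->
  swl i (swl i.+1 (swl i l)) = swl i.+1 (swl i (swl i.+1 l)).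
Proof.
move=> hi hj; apply: lam_ext => k hk.
rewrite !vl_swl ?sw_range //; congr (vl l _).
by rewrite /sw; repeat case: eqP; lia.
Qed.

Lemma vl_swl_l i l : 0 < i < n -> vl (swl i l) i = vl l i.+1.
Proof. by move=> hi; rewrite vl_swl ?/sw ?eqxx //; lia. Qed.

Lemma vl_swl_r i l : 0 < i < n -> vl (swl i l) i.+1 = vl l i.
Proof. by move=> hi; rewrite vl_swl /sw; repeat case: eqP; lia. Qed.

Lemma swl_fix i l : 0 < i < n -> (swl i l == l) = (vl l i == vl l i.+1).
Proof.
move=> hi; apply/eqP/eqP => [e|h]; first by rewrite -{1}e vl_swl_l.
by apply: lam_ext => j hj; rewrite vl_swl // /sw; do 2?case: eqP => [->|_].
Qed.

Lemma vl_swl_o i l j : 0 < i < n -> 0 < j <= n -> j != i -> j != i.+1 ->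
  vl (swl i l) j = vl l j.
Proof. by move=> hi hj /negPf a /negPf b; rewrite vl_swl // /sw a b. Qed.

Lemma dominantP l :
  reflect (forall i, 0 < i < n -> vl l i <= vl l i.+1) (dominant l).
Proof.
apply: (iffP forallP) => [h i hi|h p].
  have hi0 : i.-1 < n by lia.
  have hi1 : i < n by lia.
  have := h (Ordinal hi0) => /forallP/(_ (Ordinal hi1))/implyP /=.
  rewrite -!vl_ord /= prednK; last by lia.
  by apply; lia.
apply/forallP=> q; apply/implyP=> pq; rewrite -!vl_ord.
have: q < n by [].
move: pq; move: (nat_of_ord q) => k; elim: k => [|k IH].
  by rewrite leqn0 => /eqP->.
rewrite leq_eqVlt => /predU1P[->//|pk kn].
by apply: leq_trans (IH _ _) (h k.+1 _); lia.
Qed.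

Lemma dominant_mono l j k : dominant l -> 0 < j -> j <= k -> k <= n -> vl l j <= vl l k.
Proof.
move=> /dominantP h j0; elim: k => [|k IH]; first by lia.
rewrite leq_eqVlt => /predU1P[->//|jk kn].
by apply: leq_trans (IH _ _) (h k _); lia.
Qed.

(* Sorting terminates since exchanging a descent decreases this weight. *)
Definition weight l := \sum_(p < n) (n - p.+1) * vl l p.+1.

Lemma weight_swl i l : 0 < i < n -> vl l i.+1 < vl l i -> weight (swl i l) < weight l.
Proof.
move=> hi d; have hi0 : i.-1 < n by lia.
have hi1 : i < n by lia.
pose a := Ordinal hi0; pose b := Ordinal hi1.
have ba : b != a by rewrite -val_eqE /=; lia.
rewrite /weight (bigD1 a) // (bigD1 b) //= [X in _ < X](bigD1 a) // [X in _ < _ + X](bigD1 b) //=.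
rewrite !addnA.
set S := (X in _ + X < _); set S' := (X in _ < _ + X).
have -> : S = S'.
  apply: eq_bigr => p; rewrite -!val_eqE /= => /andP[pa pb].
  by have pn := ltn_ord p; rewrite vl_swl_o //; lia.
rewrite ltn_add2r (_ : i.-1.+1 = i); last by lia.
rewrite vl_swl_l // vl_swl_r //.
have -> : n - i = (n - i.+1).+1 by lia.
nia.
Qed.

Lemma sort_ind (P : Lam n r -> Prop) :
  (forall l, (forall i, 0 < i < n -> vl l i.+1 < vl l i -> P (swl i l)) -> P l) ->
  forall l, P l.
Proof.
move=> h l; have [k] := ubnP (weight l); elim: k l => // k IH l lk.
by apply: h => i hi d; apply: IH; apply: leq_trans (weight_swl hi d) _.
Qed.

Lemma not_dominant l : ~~ dominant l -> exists2 i, 0 < i < n & vl l i.+1 < vl l i.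
Proof.
move=> nd; case: (pickP (fun p : 'I_n => (0 < p) && (vl l p.+1 < vl l p))) => [p /andP[p0 d]|h].
  by exists p; rewrite // p0 /=.
case/negP: nd; apply/dominantP => i hi; have hi' : i < n by lia.
by have /= := h (Ordinal hi'); rewrite leqNgt; lia.
Qed.

Lemma sort_ind1 (P : Lam n r -> Prop) :
  (forall l, dominant l -> P l) ->
  (forall l i, 0 < i < n -> vl l i.+1 < vl l i -> P (swl i l) -> P l) ->
  forall l, P l.
Proof.
move=> h0 h1; apply: sort_ind => l IH.
have [/h0//|/not_dominant[i hi d]] := boolP (dominant l).
by apply: h1 hi d (IH i hi d).
Qed.

Lemma orbW_refl l : l \in orbW l.
Proof. by apply/imsetP; exists 1%g => //; apply/ffunP=> p; rewrite ffunE perm1. Qed.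

Lemma orbW_trans l m (x : Lam n r) : m \in orbW l -> x \in orbW m -> x \in orbW l.
Proof.
case/imsetP=> s _ -> /imsetP[t _ ->]; apply/imsetP; exists (t * s)%g => //.
by apply/ffunP=> p; rewrite !ffunE permM.
Qed.

Lemma orbW_sym l m : m \in orbW l -> l \in orbW m.
Proof.
case/imsetP=> s _ ->; apply/imsetP; exists s^-1%g => //.
by apply/ffunP=> p; rewrite !ffunE permKV.
Qed.

Lemma swl_orbW i l : 0 < i < n -> swl i l \in orbW l.
Proof.
move=> hi; have hi0 : i.-1 < n by lia.
have hi1 : i < n by lia.
apply/imsetP; exists (tperm (Ordinal hi0) (Ordinal hi1)) => //.
apply/ffunP=> p; rewrite !ffunE; congr (l _); apply: val_inj.
have hs : (sw i p.+1).-1 < n.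
  by have := @sw_range i p.+1 hi (ltn_ord p); lia.
rewrite /insubd (insubT (fun k => k < n) hs) /= /sw.
case: tpermP => [->|->|/eqP a /eqP b] /=; first by case: eqP; lia.
  by repeat case: eqP; lia.
move: a b; rewrite -!val_eqE /=; repeat case: eqP; lia.
Qed.

(** Both tuples list the same multiset of exponents in increasing order. *)
Lemma dominant_uniq l m : dominant l -> dominant m -> m \in orbW l -> m = l.
Proof.
move=> dl dm /imsetP[s _ e].
pose sq (x : Lam n r) := [seq (nat_of_ord (x p)) | p <- enum 'I_n].
have srt x : dominant x -> sorted leq (sq x).
  move=> dx; rewrite sorted_map.
  have: sorted ltn [seq nat_of_ord p | p <- enum 'I_n].
    by rewrite val_enum_ord iota_ltn_sorted.
  rewrite sorted_map; apply: sub_sorted => p q /= pq.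
  move/forallP/(_ p)/forallP/(_ q)/implyP: dx; apply; exact: ltnW.
have pe : perm_eq (sq m) (sq l).
  have -> : sq m = [seq nat_of_ord (l p) | p <- [seq s p | p <- enum 'I_n]].
    by rewrite -map_comp; apply: eq_map => p; rewrite /= e ffunE.
  apply: perm_map; apply: uniq_perm; rewrite ?enum_uniq //.
    by rewrite map_inj_uniq ?enum_uniq //; apply: perm_inj.
  move=> p; rewrite mem_enum; apply/mapP; exists (s^-1%g p); rewrite ?mem_enum //.
  by rewrite permKV.
have sqe := sorted_eq leq_trans anti_leq (srt m dm) (srt l dl) pe.
apply/ffunP=> p; apply: val_inj.
by have /eq_in_map/(_ p) := sqe; apply; rewrite mem_enum.
Qed.

Lemma lam0P l : dominant (lam0 l) /\ lam0 l \in orbW l.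
Proof.
have [m mo md] : exists2 m, m \in orbW l & dominant m.
  elim/sort_ind1: l => [l dl|l i hi _ [m mo md]]; first by exists l; rewrite ?orbW_refl.
  by exists m => //; apply: orbW_trans mo; apply: swl_orbW.
rewrite /lam0; case: pickP => [k /andP[]//|/(_ m)].
by rewrite /= mo md.
Qed.

Lemma lam0_orb l m : m \in orbW l -> lam0 m = lam0 l.
Proof.
move=> mo; have [dl ol] := lam0P l; have [dm om] := lam0P m.
apply: dominant_uniq => //; apply: orbW_trans om.
by apply: orbW_trans mo; apply: orbW_sym.
Qed.

Lemma mem_orbW l m : (m \in orbW l) = (lam0 m == lam0 l).
Proof.
apply/idP/eqP => [/lam0_orb//|e].
have [_ ol] := lam0P l; have [_ om] := lam0P m.
by apply: orbW_trans ol _; rewrite -e; apply: orbW_sym.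
Qed.

Lemma lam0_id l : dominant l -> lam0 l = l.
Proof. by move=> dl; have [d o] := lam0P l; apply: dominant_uniq. Qed.

Lemma lam0_swl i l : 0 < i < n -> lam0 (swl i l) = lam0 l.
Proof. by move=> hi; apply: lam0_orb; apply: swl_orbW. Qed.

(* [st l j] is the position to which the stable sorting of [l] moves its [j]-th entry. *)
Definition stle l k j := (vl l k < vl l j) || (vl l k == vl l j) && (k <= j).
Definition st l j := count (fun k => stle l k j) (iota 1 n).

Lemma st_range l j : 0 < j <= n -> 0 < st l j <= n.
Proof.
move=> hj; rewrite -[in X in _ && X](size_iota 1 n) count_size andbT -has_count.
by apply/hasP; exists j; rewrite ?mem_iota ?/stle; lia.
Qed.

Lemma st_lt l j k : 0 < j <= n -> 0 < k <= n -> j != k -> stle l j k -> st l j < st l k.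
Proof.
move=> hj hk jk le; rewrite /st.
(* By transitivity everything counted for [j] is counted for [k]; the remainder contains [k]
   itself. *)
have -> : count (fun i => stle l i k) (iota 1 n) =
  count (predI (fun i => stle l i k) (fun i => stle l i j)) (iota 1 n)
  + count (predI (fun i => stle l i k) (fun i => ~~ stle l i j)) (iota 1 n).
  by elim: (iota 1 n) => //= a s ->; case: stle; case: stle => //=; lia.
rewrite [X in _ < X + _](_ : _ = count (fun i => stle l i j) (iota 1 n)); last first.
  by apply: eq_count => i /=; move: le; rewrite /stle; lia.
rewrite -ltn_subLR ?subnn // -has_count; apply/hasP; exists k => /=.
  by rewrite mem_iota; lia.
by move: le; rewrite /stle; lia.
Qed.

Lemma st_inj l j k : 0 < j <= n -> 0 < k <= n -> st l j = st l k -> j = k.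
Proof.
move=> hj hk e; apply/eqP; case: (eqVneq j k) => // jk.
have : stle l j k \/ stle l k j by rewrite /stle; lia.
by case=> [/(st_lt hj hk jk)|/(st_lt hk hj)]; rewrite ?e ?ltnn // eq_sym jk; lia.
Qed.

(** Between equal neighbours the only newly counted position is [i.+1] itself. This is where
    stability matters: equal neighbours stay adjacent. *)
Lemma stS l i : 0 < i < n -> vl l i = vl l i.+1 -> st l i.+1 = (st l i).+1.
Proof.
move=> hi e; rewrite /st.
have -> : count (fun k => stle l k i.+1) (iota 1 n) =
   count (fun k => stle l k i) (iota 1 n) + count (pred1 i.+1) (iota 1 n).
  rewrite -count_predUI [X in _ = _ + X](_ : _ = 0) ?addn0.
    by apply: eq_count => k; rewrite /= /stle; case: (k =P i.+1) => [->|?]; rewrite -?e; lia.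
  rewrite -[RHS](count_pred0 (iota 1 n)); apply: eq_count => k.
  by rewrite /= /stle; case: (k =P i.+1) => [->|_]; lia.
by rewrite count_uniq_mem ?iota_uniq // mem_iota; lia.
Qed.

(** Distinct entries are compared by value alone, so exchanging them merely renames the counted
    positions. For equal entries the tie-break by position would spoil this. *)
Lemma st_swl i l j : 0 < i < n -> vl l i != vl l i.+1 -> 0 < j <= n ->
  st (swl i l) j = st l (sw i j).
Proof.
move=> hi ne hj; rewrite /st.
have pe : perm_eq (iota 1 n) [seq sw i k | k <- iota 1 n].
  have inj : injective (sw i) := inv_inj (swK i).
  apply: uniq_perm; rewrite ?map_inj_uniq ?iota_uniq // => k.
  rewrite -{2}(swK i k) mem_map // !mem_iota.
  by rewrite /sw; repeat case: eqP; lia.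
rewrite (seq.permP pe) count_map; apply: eq_in_count => k; rewrite mem_iota /= => hk.
have hs := @sw_range i k hi ltac:(lia).
rewrite /stle !vl_swl ?swK //.
move: ne; rewrite /sw.
by case: (k =P i) => [->|?]; case: (j =P i) => [->|?]; try case: (k =P i.+1) => [->|?];
  try case: (j =P i.+1) => [->|?]; lia.
Qed.

Lemma st_swl_o l i j : 0 < i < n -> 0 < j <= n -> j != i -> j != i.+1 ->
  st (swl i l) j = st l j.
Proof.
move=> hi hj j1 j2; case: (eqVneq (vl l i) (vl l i.+1)) => e.
  by move/eqP: e; rewrite -swl_fix // => /eqP->.
by rewrite st_swl // sw_o.
Qed.

Lemma st_fix_range l i : 0 < i < n -> vl l i = vl l i.+1 -> 0 < st l i < n.
Proof.
move=> hi e; have := @st_range l i.+1 ltac:(lia); rewrite stS //.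
by have := @st_range l i ltac:(lia); lia.
Qed.

(** Four distinct places go to four distinct places, in two adjacent pairs. The order of the pairs
    may be reversed by sorting, but the corresponding T's commute either way. *)
Lemma st_far l i j : 0 < i -> i.+1 < j -> j < n -> vl l i = vl l i.+1 -> vl l j = vl l j.+1 ->
  (st l i).+1 < st l j \/ (st l j).+1 < st l i.
Proof.
move=> i0 ij jn ei ej.
have inj a b : 0 < a <= n -> 0 < b <= n -> a != b -> st l a != st l b.
  by move=> ha hb; apply: contra_neq; apply: st_inj.
have := inj i j; have := inj i.+1 j; have := inj i j.+1.
by rewrite !stS //; lia.
Qed.

Lemma st_dominant l j : dominant l -> 0 < j <= n -> st l j = j.
Proof.
move=> dl hj; rewrite /st (_ : count _ _ = count (fun k => k <= j) (iota 1 n)); last first.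
  apply: eq_in_count => k; rewrite mem_iota /stle => hk.
  have := @dominant_mono l k j dl; have := @dominant_mono l j k dl.
  by lia.
have -> : n = j + (n - j) by lia.
rewrite iotaD count_cat.
rewrite (_ : count _ (iota 1 j) = j); last first.
  rewrite -[RHS](size_iota 1 j); apply/eqP; rewrite -all_count; apply/allP=> k.
  by rewrite mem_iota; lia.
rewrite (_ : count _ _ = 0) ?addn0 //; apply/eqP; rewrite -leqn0 leqNgt -has_count.
by apply/hasPn=> k; rewrite mem_iota; lia.
Qed.

Lemma vl_lam0_st l j : 0 < j <= n -> vl (lam0 l) (st l j) = vl l j.
Proof.
elim/sort_ind1: l j => [l dl|l i hi d IH] j hj; first by rewrite lam0_id // st_dominant.
have hs := sw_range hi hj.
have := IH _ hs; rewrite lam0_swl // st_swl ?swK //; last by lia.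
by rewrite vl_swl ?swK.
Qed.

End Tuples.

(** * Affine braid relations *)

Section AffineBraid.
Variables (A : nzRingType) (n : nat).
Implicit Types (G : nat -> A) (z x y : A) (i j k m : nat).

Lemma mulr3 (x a b c : A) : x * a * b * c = x * (a * b * c).
Proof. by rewrite !mulrA. Qed.

Definition braided G :=
  (forall i j, (0 < i)%N -> (i.+1 < j)%N -> (j < n)%N -> G i * G j = G j * G i) /\
  (forall i, (0 < i)%N -> (i.+1 < n)%N -> G i * G i.+1 * G i = G i.+1 * G i * G i.+1).

Definition affine_braided G z :=
  (forall i, (1 < i < n)%N -> G i * z = z * G i) /\
  ((1 < n)%N -> G 1%N * z * G 1%N * z = z * G 1%N * z * G 1%N).

(* Jucys-Murphy type elements, numbered from 1 ([jm G z 0] is junk). *)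
Fixpoint jm G z j : A :=
  match j with
  | 0 => z
  | k.+1 => if k is 0 then z else G k * jm G z k * G k
  end.

Lemma jmS G z j : (0 < j)%N -> jm G z j.+1 = G j * jm G z j * G j.
Proof. by case: j. Qed.

Lemma jm_inv G Gi z zi j : (forall i, (0 < i < n)%N -> G i * Gi i = 1) ->
  z * zi = 1 -> (j <= n)%N -> jm G z j * jm Gi zi j = 1.
Proof.
move=> GK zK; elim: j => [|[|j] IH] jn //.
rewrite [jm G _ _]jmS // [jm Gi _ _]jmS //.
rewrite !mulrA -(mulrA _ (G j.+1)) GK ?mulr1; last by lia.
rewrite -(mulrA _ (jm G z _)) IH ?mulr1 ?GK //; lia.
Qed.

Section Commutation.
Variables (G : nat -> A) (z : A).
Hypotheses (Gb : braided G) (Gz : affine_braided G z).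
Let far := Gb.1.
Let brd := Gb.2.
Local Notation J := (jm G z).

Lemma jm_comm_gt i j : (0 < j)%N -> (j < i < n)%N -> GRing.comm (G i) (J j).
Proof.
elim: j => // -[|j] IH _ hi; first by apply: Gz.1; lia.
rewrite jmS //.
have c1 : GRing.comm (G i) (G j.+1) by apply: esym; apply: far; lia.
by apply: commrM => //; apply: commrM => //; apply: IH; lia.
Qed.

Lemma jm_comm_lt i j : (0 < i)%N -> (i.+1 < j <= n)%N -> GRing.comm (G i) (J j).
Proof.
move=> i0; elim: j => // j IH hj.
rewrite jmS; last by lia.
case: (ltnP i.+1 j) => ij.
  have c1 : GRing.comm (G i) (G j) by apply: far; lia.
  by apply: commrM => //; apply: commrM => //; apply: IH; lia.
(* The critical case: J_(i+2) = G_(i+1) G_i J_i G_i G_(i+1), and G_i crosses it by two braid moves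
   around the commuting pair G_(i+1), J_i. *)
have {ij hj IH} [ji hi] : j = i.+1 /\ (i.+1 < n)%N by lia.
subst j; rewrite jmS // /GRing.comm.
have c1 : J i * G i.+1 = G i.+1 * J i by apply: esym; apply: jm_comm_gt; lia.
rewrite !mulrA brd // -(mulrA _ (G i.+1) (J i)) -c1 mulrA.
by rewrite mulr3 -brd // !mulrA.
Qed.

(** The type B braid relation between G_1 and [z] propagates along the sequence; it amounts to the
    commutation of J_j with J_(j+1). *)
Lemma jm_adj j : (0 < j < n)%N -> G j * J j * G j * J j = J j * G j * J j * G j.
Proof.
elim: j => // -[|j] IH hj; first by apply: Gz.2; lia.
have {}IH := IH ltac:(lia); rewrite jmS //.
set a := G j.+1; set b := G j.+2; set y := J j.+1.
have yb : y * b = b * y by apply: esym; apply: jm_comm_gt; lia.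
have ab : a * b * a = b * a * b by apply: brd; lia.
rewrite -/a -/y in IH.
(* This form exposes [a * y * a * y], to which the relation one step down applies. *)
transitivity (a * b * (a * y * a * y) * b * a).
  have -> : b * (a * y * a) * b * (a * y * a) = b * a * y * (a * b * a) * y * a by rewrite !mulrA.
  have -> : a * b * (a * y * a * y) * b * a = (a * b * a) * y * a * (y * b) * a by rewrite !mulrA.
  rewrite ab yb !mulrA -(mulrA _ y b) yb !mulrA; reflexivity.
rewrite IH.
have -> : a * y * a * b * (a * y * a) * b = a * y * (a * b * a) * y * a * b by rewrite !mulrA.
have -> : a * b * (y * a * y * a) * b * a = a * (b * y) * a * y * (a * b * a) by rewrite !mulrA.
by rewrite ab -yb !mulrA -(mulrA _ b y) -yb !mulrA.
Qed.

Lemma jm_comm j k : (0 < j <= n)%N -> (0 < k <= n)%N -> GRing.comm (J j) (J k).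
Proof.
suff lt a b : (0 < a)%N -> (a < b <= n)%N -> GRing.comm (J a) (J b).
  move=> hj hk; case: (ltngtP j k) => [h|h|->] //; first by apply: lt; lia.
  by apply: commr_sym; apply: lt; lia.
move=> a0; elim: b => // b IH hb; rewrite jmS; last by lia.
case: (ltnP a b) => ab.
  have c1 : GRing.comm (J a) (G b) by apply: commr_sym; apply: jm_comm_gt; lia.
  by apply: commrM => //; apply: commrM => //; apply: IH; lia.
have {IH hb ab} [-> bn] : b = a /\ (a < n)%N by lia.
by rewrite /GRing.comm !mulrA -jm_adj //; lia.
Qed.

End Commutation.

(** * Descending products and the rotation *)

Fixpoint desc G a k : A := if k is k'.+1 then G (a + k)%N * desc G a k' else 1.
Fixpoint asc G k : A := if k is k'.+1 then asc G k' * G k else 1.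

Lemma jm_desc G z j : jm G z j.+1 = desc G 0 j * z * asc G j.
Proof. by elim: j => [|j IH]; rewrite ?mul1r ?mulr1 // jmS // IH /= !mulrA. Qed.

Lemma desc_cat G a k m : desc G (a + k) m * desc G a k = desc G a (k + m).
Proof.
elim: m => [|m IH]; first by rewrite mul1r addn0.
by rewrite addnS /= -mulrA IH !addnS addnA.
Qed.

Lemma desc_inv G Gi a k : (forall i, (0 < i < n)%N -> G i * Gi i = 1 /\ Gi i * G i = 1) ->
  (a + k < n)%N -> exists d, desc G a k * d = 1 /\ d * desc G a k = 1.
Proof.
move=> GK; elim: k => [|k IH] ak; first by exists 1; rewrite mulr1.
have [|d [d1 d2]] := IH; first by lia.
have [g1 g2] := GK (a + k.+1)%N ltac:(lia).
exists (d * Gi (a + k.+1)%N) => /=.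
by rewrite !mulrA -(mulrA _ _ d) d1 mulr1 g1 -(mulrA d) g2 mulr1.
Qed.

Section Rotation.
Variables (G : nat -> A).
Hypotheses (Gb : braided G).
Let far := Gb.1.
Let brd := Gb.2.

Lemma desc_comm m i : (m.+1 < i < n)%N -> GRing.comm (desc G 0 m) (G i).
Proof.
elim: m => [|m IH] hi /=; first exact: commr_sym (commr1 _).
by apply: commr_sym; apply: commrM; apply: commr_sym; [apply: far; lia|apply: IH; lia].
Qed.

(** A descending product acts on interior generators as a shift of the index. Generators below the
    top follow by induction; the top one needs a braid relation. *)
Lemma desc_shift m i : (1 < i <= m)%N -> (m < n)%N -> desc G 0 m * G i = G i.-1 * desc G 0 m.
Proof.
elim: m => [|m IH] hi hm /=; first by lia.
rewrite add0n; case: (ltnP i m.+1) => im.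
  rewrite -mulrA IH ?mulrA ?(far (i := i.-1)) //; lia.
have {im}hi' : i = m.+1 by lia.
subst i; case: m IH hi hm => [|m] IH hi hm; first by lia.
rewrite /= add0n.
have c1 : desc G 0 m * G m.+2 = G m.+2 * desc G 0 m by apply: desc_comm; lia.
rewrite -!mulrA c1 !mulrA brd //; lia.
Qed.

Hypothesis n1 : (1 < n)%N.
Local Notation c := (desc G 0 n.-1).
Local Notation d := (desc G 1 n.-2).

Lemma descE_last : c = G n.-1 * desc G 0 n.-2.
Proof. by have -> : n.-1 = n.-2.+1 by lia. Qed.

Lemma descE_first : c = d * G 1%N.
Proof.
have -> : n.-1 = (1 + n.-2)%N by lia.
by rewrite -desc_cat /= mulr1.
Qed.

(** Carrying [d] across [c] lowers its indices by one and turns it into [desc G 0 n.-2]. *)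
Lemma desc_square : G n.-1 * c * d = c * c.
Proof.
transitivity (G n.-1 * (desc G 0 n.-2 * c)); last by rewrite mulrA -descE_last.
rewrite -mulrA; congr (_ * _).
suff h k : (k <= n.-2)%N -> c * desc G 1 k = desc G 0 k * c by apply: h.
elim: k => [|k IH] hk /=; first by rewrite mulr1 mul1r.
rewrite mulrA desc_shift ?add1n -?mulrA ?IH ?add0n //; lia.
Qed.

Section Rot.
Variable z : A.
Hypothesis Gz : forall i, (1 < i < n)%N -> G i * z = z * G i.

Lemma z_desc1 : z * d = d * z.
Proof.
suff h k : (k <= n.-2)%N -> GRing.comm z (desc G 1 k) by apply: h.
elim: k => [|k IH] hk /=; first exact: commr1.
by apply: commrM; [apply: esym; apply: Gz; lia|apply: IH; lia].
Qed.

Lemma rot_shift i : (1 < i < n)%N -> (c * z) * G i = G i.-1 * (c * z).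
Proof. by move=> hi; rewrite -mulrA -Gz // !mulrA desc_shift //; lia. Qed.

Lemma rot_square : c * z * (c * z) = c * d * (z * G 1%N * z).
Proof. by rewrite [in X in _ * X]descE_first !mulrA -(mulrA c z) z_desc1 !mulrA. Qed.

(** One turn would send G_1 to an absent G_0; two turns bring it to G_(n-1). This encodes the type B
    relation between G_1 and [z] in terms of the rotation. *)
Lemma rot_square_shift : G 1%N * z * G 1%N * z = z * G 1%N * z * G 1%N ->
  c * z * (c * z) * G 1%N = G n.-1 * (c * z * (c * z)).
Proof.
move=> zz; rewrite rot_square !mulrA desc_square.
rewrite (_ : c * d * z * G 1%N * z * G 1%N = c * d * (z * G 1%N * z * G 1%N)); last by rewrite !mulrA.
by rewrite -zz !mulrA -(mulrA c d) -descE_first.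
Qed.

End Rot.

Section Unrot.
Variables (Gi : nat -> A) (w ci : A).
Hypothesis GK : forall i, (0 < i < n)%N -> G i * Gi i = 1 /\ Gi i * G i = 1.
Hypotheses (cK : ci * c = 1) (cVK : c * ci = 1).
Hypothesis wG : forall i, (1 < i < n)%N -> w * G i = G i.-1 * w.
Hypothesis wwG : w * w * G 1%N = G n.-1 * (w * w).

Lemma unrot_comm i : (1 < i < n)%N -> G i * (ci * w) = ci * w * G i.
Proof.
move=> hi; rewrite -mulrA wG // mulrA.
rewrite -[G i](mul1r) -cK -(mulrA ci) desc_shift; try lia.
by rewrite !mulrA -(mulrA _ c ci) cVK mulr1.
Qed.

(** The converse of [rot_square_shift]: an element that behaves like the rotation yields a first
    affine generator [ci * w]. Both sides are compared after multiplication by [c * d], which can be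
    cancelled on the left. *)
Lemma unrot_braid :
  G 1%N * (ci * w) * G 1%N * (ci * w) = ci * w * G 1%N * (ci * w) * G 1%N.
Proof.
have cz : c * (ci * w) = w by rewrite mulrA cVK mul1r.
have := unrot_comm; move: cz; move: (ci * w) => z cz z_comm.
have [g1 g2] := GK (i := 1%N) ltac:(lia).
have cdK x y : c * d * x = c * d * y -> x = y.
  have dK : G 1%N * ci * d = 1.
    by rewrite -[d]mulr1 -g1 !mulrA -(mulrA _ d) -descE_first -(mulrA _ ci) cK mulr1.
  move=> e; rewrite -[x]mul1r -[y]mul1r -dK -[d]mul1r -cK.
  by rewrite -!mulrA in e *; rewrite e.
apply: cdK; move: wwG; rewrite -cz (rot_square z_comm) !mulrA => e.
by rewrite e -(mulrA c d) -descE_first -desc_square.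
Qed.

End Unrot.
End Rotation.
End AffineBraid.

(** * The matrix representation of the algebra H over the affine Hecke algebra *)

Section MatrixModel.
Variables (n r : nat) (hn : (0 < n)%N) (l0 : Lam n r).
Variables (R : comNzRingType) (q qi : R) (A : algType R) (genA : AG -> A).
Hypothesis relA : Arel n q qi genA.
Local Notation M := (ffmx A l0).
Local Notation T i := (genA (AT i)).
Local Notation Z i := (genA (AZ i)).
Local Notation Zi i := (genA (AZi i)).

Lemma A_far i j : (0 < i)%N -> (i.+1 < j)%N -> (j < n)%N -> T i * T j = T j * T i.
Proof. by move=> i0 ij jn; apply: relA.1; lia. Qed.

Lemma A_braid i : (0 < i)%N -> (i.+1 < n)%N -> T i * T i.+1 * T i = T i.+1 * T i * T i.+1.
Proof. by move=> i0 jn; apply: relA.2.1; lia. Qed.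

Lemma A_quad i : (0 < i < n)%N -> T i ^+ 2 = 1 + (q - qi) *: T i.
Proof. by move=> hi; apply: relA.2.2.1; lia. Qed.

Lemma A_ZZ j k : (0 < j <= n)%N -> (0 < k <= n)%N -> Z j * Z k = Z k * Z j.
Proof. exact: relA.2.2.2.1. Qed.

Lemma A_ZK j : (0 < j <= n)%N -> Z j * Zi j = 1 /\ Zi j * Z j = 1.
Proof. exact: relA.2.2.2.2.1. Qed.

Lemma A_TZ i j : (0 < i < n)%N -> (0 < j <= n)%N -> j != i -> j != i.+1 -> T i * Z j = Z j * T i.
Proof. by move=> hi; apply: relA.2.2.2.2.2.1; lia. Qed.

Lemma A_Zrec i : (0 < i < n)%N -> Z i.+1 = T i * Z i * T i.
Proof. by move=> hi; apply: relA.2.2.2.2.2.2; lia. Qed.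

Definition coef i (y : Lam n r) : A := if vl y i == vl y i.+1 then T (st y i) else 1.

Definition model (x : HG n r) : M :=
  match x with
  | Hg i => monomial l0 (swl i) (coef i)
  | He l => monomial l0 id (fun y => (y == l)%:R)
  | HX => monomial l0 id (fun y => Z (st y 1))
  | HXi => monomial l0 id (fun y => Zi (st y 1))
  end.

Lemma model_far i j : (0 < i)%N -> (i.+1 < j)%N -> (j < n)%N ->
  model (Hg _ _ i) * model (Hg _ _ j) = model (Hg _ _ j) * model (Hg _ _ i).
Proof.
move=> i0 ij jn; rewrite !monomialM; apply: eq_monomial => y /=; first by rewrite swl_comm //; lia.
have -> : coef i (swl j y) = coef i y.
  by rewrite /coef !vl_swl_o ?st_swl_o //; lia.
have -> : coef j (swl i y) = coef j y.
  by rewrite /coef !vl_swl_o ?st_swl_o //; lia.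
rewrite /coef; case: eqP => ei; case: eqP => ej; rewrite ?mulr1 ?mul1r //.
have fi := @st_fix_range n r y i ltac:(lia) ei; have fj := @st_fix_range n r y j ltac:(lia) ej.
have [far|far] := st_far i0 ij jn ei ej; [|symmetry]; apply: A_far; lia.
Qed.

Lemma model_braid i : (0 < i)%N -> (i.+1 < n)%N ->
  model (Hg _ _ i) * model (Hg _ _ i.+1) * model (Hg _ _ i) =
  model (Hg _ _ i.+1) * model (Hg _ _ i) * model (Hg _ _ i.+1).
Proof.
move=> i0 ij; rewrite !monomialM; apply: eq_monomial => y /=; first by rewrite swl_braid //; lia.
have hi : (0 < i < n)%N by lia.
have hj : (0 < i.+1 < n)%N by lia.
have h0 : (0 < i <= n)%N by lia.
have h1 : (0 < i.+1 <= n)%N by lia.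
have h2 : (0 < i.+2 <= n)%N by lia.
have o1 : sw i i.+2 = i.+2 by apply: sw_o; lia.
have o2 : sw i.+1 i = i by apply: sw_o; lia.
have swE := (sw_l, sw_r, o1, o2).
rewrite /coef.
do 4?rewrite vl_swl ?swE //.
do 4?rewrite vl_swl ?swE //.
do 4?rewrite vl_swl ?swE //.
(* Three equal entries require a braid relation among the T's. In the other cases at most one
   coefficient differs from 1, and both sides send the equal pair to the same place. *)
case: (eqVneq (vl y i) (vl y i.+1)) => ab; case: (eqVneq (vl y i.+1) (vl y i.+2)) => bc.
- have fi : swl i y = y by apply/eqP; rewrite swl_fix //; apply/eqP.
  have fj : swl i.+1 y = y by apply/eqP; rewrite swl_fix //; apply/eqP.
  rewrite ab bc eqxx !(fi, fj) (stS _ ab) //.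
  apply: A_braid; first by have := @st_range n r y i; lia.
  by rewrite -!stS //; have := @st_range n r y i.+2; lia.
- rewrite ab (negPf bc) !mul1r !mulr1 st_swl ?vl_swl ?swE //; last by rewrite ab.
  by rewrite st_swl ?swE.
- rewrite -bc (negPf ab) !mulr1 st_swl ?vl_swl ?swE //; last by rewrite -bc.
  by rewrite st_swl ?swE ?mul1r.
- case: eqP => ac; rewrite ?mulr1 ?mul1r // st_swl ?swE //.
  by rewrite st_swl ?swE.
Qed.

Lemma coef_e i y l : (0 < i < n)%N ->
  coef i y * (y == l)%:R = (swl i y == swl i l)%:R * coef i y.
Proof.
move=> hi; rewrite (inj_eq (can_inj (fun x => swlK x hi))).
by case: eqP; rewrite ?mulr1 ?mul1r ?mulr0 ?mul0r.
Qed.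

Lemma model_quad i : (0 < i < n)%N -> model (Hg _ _ i) ^+ 2 =
  1 + (q - qi) *: \sum_(l | swl i l == l) model (Hg _ _ i) * model (He l).
Proof.
move=> hi; under eq_bigr => l _ do rewrite monomialM.
apply/ffunP=> -[x y]; rewrite expr2 monomialM [LHS]ffunE /= !ffunE sum_ffunE /=.
rewrite swlK //.
have -> : \sum_(l | swl i l == l) monomial l0 (swl i \o id) (fun z => coef i z * (z == l)%:R) (x, y)
   = if (x == y) && (swl i y == y) then coef i y else 0.
  under eq_bigr => l _ do rewrite ffunE /=.
  case: ifP => [/andP[/eqP-> fy]|h].
    rewrite (bigD1 y) //= big1 ?addr0 => [|l /andP[_ ly]]; first by rewrite (eqP fy) !eqxx mulr1.
    by rewrite eq_sym in ly; rewrite (negPf ly) mulr0; case: ifP.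
  apply: big1 => l fl; case: eqP => // xy; case: eqP => yl; rewrite ?mulr0 //.
  by move: h; rewrite xy yl /= fl.
case: (x =P y) => [_|_]; last by rewrite scaler0 addr0.
rewrite swl_fix //= /coef vl_swl_l // vl_swl_r //.
case: (eqVneq (vl y i) (vl y i.+1)) => e; last by rewrite scaler0 addr0 mulr1.
have/eqP -> : swl i y == y by rewrite swl_fix // e.
by rewrite -expr2 A_quad //; apply: st_fix_range.
Qed.

Lemma model_XX : (1 < n)%N ->
  model (Hg _ _ 1) * model (HX n r) * model (Hg _ _ 1) * model (HX n r) =
  model (HX n r) * model (Hg _ _ 1) * model (HX n r) * model (Hg _ _ 1).
Proof.
move=> n1; have h1 : (0 < 1 < n)%N by lia.
rewrite !monomialM; apply: eq_monomial => y //=; rewrite /coef vl_swl_l // vl_swl_r //.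
(* For equal entries the relation becomes the commutation of Z_k with Z_(k+1) = T_k Z_k T_k; for
   distinct ones, that of the Z's at the two places. *)
case: (eqVneq (vl y 1) (vl y 2)) => e.
  have fy : swl 1 y = y by apply/eqP; rewrite swl_fix // e.
  rewrite !fy.
  have hs := st_fix_range h1 e.
  have zr := A_Zrec hs.
  rewrite -zr -!mulrA [in RHS](mulrA (T _)) -zr.
  by apply: esym; apply: A_ZZ; lia.
rewrite !swlK // !mul1r !mulr1 st_swl // sw_l.
by apply: A_ZZ; apply: st_range; lia.
Qed.

Lemma model_gX i : (1 < i < n)%N ->
  model (Hg _ _ i) * model (HX n r) = model (HX n r) * model (Hg _ _ i).
Proof.
move=> hi; rewrite !monomialM; apply: eq_monomial => y //=.
rewrite st_swl_o /coef; try lia; case: eqP => e; rewrite ?mul1r ?mulr1 //.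
have ne a b : (0 < a <= n)%N -> (0 < b <= n)%N -> a != b -> st y a != st y b.
  by move=> ha hb; apply: contra_neq; apply: st_inj.
have hi' : (0 < i < n)%N by lia.
have := ne 1%N i; have := ne 1%N i.+1; rewrite (stS hi' e) => n1 n2.
have := st_fix_range hi' e; have := @st_range n r y 1%N hn => s1 si.
by apply: A_TZ; lia.
Qed.

Lemma model_rel : Hrel q qi model.
Proof.
split; first by move=> i j i0 ij jn; apply: model_far; lia.
split; first by move=> i i0 ij; apply: model_braid; lia.
split=> [i l hi|].
  by rewrite !monomialM; apply: eq_monomial => y //=; apply: coef_e; lia.
split.
  rewrite monomial_id_sum monomial1; apply: eq_monomial => // y.
  by rewrite (bigD1 y) //= eqxx big1 ?addr0 // => l; rewrite eq_sym => /negPf->.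
split=> [l l'|].
  rewrite monomialM; case: eqP => [<-|ne].
    by apply: eq_monomial => // y /=; case: eqP; rewrite ?mulr1 ?mulr0.
  apply/ffunP=> -[x y]; rewrite !ffunE /=; case: (x == y) => //.
  by case: eqP => [->|]; rewrite ?mul0r // mul1r; case: eqP.
split; first by move=> i hi; apply: model_quad; lia.
split.
  by rewrite monomial1 !monomialM; split; apply: eq_monomial => y //=;
    have [] := @A_ZK (st y 1) (st_range y (j := 1) hn).
split; first exact: model_XX.
split; first by move=> i hi; apply: model_gX; lia.
move=> l; rewrite !monomialM; apply: eq_monomial => // y /=.
by case: eqP; rewrite ?mulr1 ?mul1r ?mulr0 ?mul0r.
Qed.

(** The recursion for X_j matches T_k Z_k T_k where neighbours agree, and only follows an entry to
    its place where they differ. *)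
Lemma model_jm j : (0 < j <= n)%N ->
  jm (fun i => model (Hg _ _ i)) (model (HX n r)) j = monomial l0 id (fun y => Z (st y j)).
Proof.
elim: j => // -[|j] IH hj //.
have hj' : (0 < j.+1 < n)%N by lia.
rewrite jmS // IH; last by lia.
rewrite !monomialM; apply: eq_monomial => y /=; first by rewrite swlK.
rewrite /coef vl_swl_l // vl_swl_r //.
case: (eqVneq (vl y j.+1) (vl y j.+2)) => e.
  have fy : swl j.+1 y = y by apply/eqP; rewrite swl_fix // e.
  by rewrite !fy (stS hj' e) A_Zrec //; apply: st_fix_range.
by rewrite mul1r mulr1 st_swl ?sw_l //; lia.
Qed.

End MatrixModel.

(** * The homomorphism from the affine Hecke algebra to H *)

Section HeckeH.
Variables (n r : nat) (R : comNzRingType) (q qi : R) (H : algType R) (genH : HG n r -> H).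
Hypothesis relH : Hrel q qi genH.
Local Notation g i := (genH (Hg n r i)).
Local Notation gf := (fun i => genH (Hg n r i)).
Local Notation e l := (genH (He l)).
Local Notation X := (genH (HX n r)).
Local Notation Xi := (genH (HXi n r)).
Local Notation dl := (q - qi).
Implicit Types (l m : Lam n r) (i j k : nat).

Lemma g_e i l : (0 < i < n)%N -> g i * e l = e (swl i l) * g i.
Proof. by move=> hi; apply: relH.2.2.1; lia. Qed.

Lemma sum_e : \sum_l e l = 1.
Proof. exact: relH.2.2.2.1. Qed.

Lemma e_orthogonal l m : e l * e m = if l == m then e l else 0.
Proof. exact: relH.2.2.2.2.1. Qed.

Lemma e_idem l : e l * e l = e l.
Proof. by rewrite e_orthogonal eqxx. Qed.

Lemma g_sq i : (0 < i < n)%N -> g i ^+ 2 = 1 + dl *: \sum_(l | swl i l == l) g i * e l.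
Proof. by move=> hi; apply: relH.2.2.2.2.2.1; lia. Qed.

Lemma XK : X * Xi = 1 /\ Xi * X = 1.
Proof. exact: relH.2.2.2.2.2.2.1. Qed.

Lemma X_e l : X * e l = e l * X.
Proof. exact: relH.2.2.2.2.2.2.2.2.2. Qed.

Lemma g_braided : braided n gf.
Proof.
split=> [i j i0 ij jn|i i0 jn]; first by apply: relH.1; lia.
by apply: relH.2.1; lia.
Qed.

Lemma gX_affine : affine_braided n gf X.
Proof.
split=> [i hi|]; last exact: relH.2.2.2.2.2.2.2.1.
by apply: relH.2.2.2.2.2.2.2.2.1; lia.
Qed.

Lemma eq_on_e (x y : H) : (forall l, x * e l = y * e l) -> x = y.
Proof.
move=> h; rewrite -[x]mulr1 -[y]mulr1 -sum_e !mulr_sumr.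
by apply: eq_bigr => l _; apply: h.
Qed.

Definition proj (f : pred (Lam n r)) : H := \sum_(l | f l) e l.

Lemma proj_e f l : proj f * e l = (f l)%:R *: e l.
Proof.
rewrite /proj mulr_suml.
case fl: (f l); last first.
  rewrite scale0r big1 // => m fm; rewrite e_orthogonal; case: eqP => // ml.
  by move: fm; rewrite ml fl.
rewrite (bigD1 l) //= e_idem big1 ?addr0 ?scale1r // => m /andP[_ ml].
by rewrite e_orthogonal (negPf ml).
Qed.

Lemma gg_e_neq i l : (0 < i < n)%N -> vl l i != vl l i.+1 -> g i * g i * e l = e l.
Proof.
move=> hi ne; rewrite -expr2 g_sq // mulrDl mul1r -scalerAl mulr_suml big1 ?scaler0 ?addr0 //.
move=> m fm; rewrite -mulrA e_orthogonal; case: eqP => ml; rewrite ?mulr0 //.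
by move: fm; rewrite ml swl_fix // (negPf ne).
Qed.

Lemma gg_e i l : (0 < i < n)%N ->
  g i * g i * e l = e l + (dl * (vl l i == vl l i.+1)%:R) *: (g i * e l).
Proof.
move=> hi; case: eqP => [eq|/eqP ne]; last by rewrite gg_e_neq // mulr0 scale0r addr0.
rewrite -expr2 g_sq // mulrDl mul1r mulr1 -scalerAl mulr_suml; congr (_ + _ *: _).
have fl : swl i l == l by rewrite swl_fix // eq.
rewrite (bigD1 l) //= -mulrA e_idem big1 ?addr0 // => m /andP[_ ml].
by rewrite -mulrA e_orthogonal (negPf ml) mulr0.
Qed.

(** The inverse read off from the quadratic relation; off the tuples fixed by s_i the element g_i is
    its own inverse. *)
Definition ginv i := g i - dl *: proj (fun l => swl i l == l).

Lemma ginvK i : (0 < i < n)%N -> g i * ginv i = 1 /\ ginv i * g i = 1.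
Proof.
move=> hi.
have h l : (vl l i == vl l i.+1) = (swl i l == l) by rewrite swl_fix.
have pe l : ginv i * e l = g i * e l - (dl * (vl l i == vl l i.+1)%:R) *: e l.
  by rewrite mulrBl -scalerAl proj_e scalerA h.
split; apply: eq_on_e => l; rewrite mul1r -mulrA.
  by rewrite pe mulrBr mulrA gg_e // -scalerAr addrK.
rewrite g_e // mulrA pe mulrBl -mulrA -g_e // mulrA gg_e // -scalerAl -g_e //.
by rewrite vl_swl_l // vl_swl_r // eq_sym addrK.
Qed.

Definition dsc i l := (vl l i.+1 < vl l i)%N.
(** On an ascending tuple and its exchange, the correction gives the matrix with rows (0, 1) and (1,
    [dl]), whose square is 1 plus [dl] times itself: the Hecke relation. *)
Definition G i := g i + dl *: proj (dsc i).

(** The rule for expanding products of [G]'s from the right: [w] being homogeneous, the descent is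
    tested at its target [l'] and yields a scalar. *)
Lemma G_step i w l l' : w * e l = e l' * w ->
  G i * (w * e l) = g i * w * e l + (dl * (dsc i l')%:R) *: (w * e l).
Proof.
move=> hw; rewrite /G mulrDl mulrA; congr (_ + _).
by rewrite hw -scalerAl mulrA proj_e -scalerAl scalerA.
Qed.

Lemma G_e i l : G i * e l = g i * e l + (dl * (dsc i l)%:R) *: e l.
Proof. by have := @G_step i 1 l l; rewrite !mulr1 !mul1r; apply. Qed.

Lemma G_asc i l : (vl l i <= vl l i.+1)%N -> G i * e l = g i * e l.
Proof. by move=> h; rewrite G_e /dsc ltnNge h mulr0 scale0r addr0. Qed.

Lemma g_g_e i j l : (0 < i < n)%N -> (0 < j < n)%N ->
  g i * g j * e l = e (swl i (swl j l)) * (g i * g j).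
Proof. by move=> hi hj; rewrite -mulrA g_e // mulrA g_e // mulrA. Qed.

Lemma G_quad i : (0 < i < n)%N -> G i ^+ 2 = 1 + dl *: G i.
Proof.
move=> hi; apply: eq_on_e => l; rewrite expr2 -mulrA G_e mulrDr (G_step i (g_e l hi)).
rewrite gg_e // -scalerAr G_e [RHS]mulrDl mul1r -scalerAl G_e !scalerDr !scalerA !addrA.
rewrite [LHS](ACl (1*(2*3*4)*5)) /= -!scalerDl; congr (_ + _ *: _ + _ *: _);
  rewrite /dsc ?vl_swl_l ?vl_swl_r //; case: ltngtP => _ /=; ring.
Qed.

Lemma G_far i j : (0 < i)%N -> (i.+1 < j)%N -> (j < n)%N -> G i * G j = G j * G i.
Proof.
move=> i0 ij jn; have hi : (0 < i < n)%N by lia.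
have hj : (0 < j < n)%N by lia.
apply: eq_on_e => l; rewrite -!mulrA !G_e !mulrDr (G_step i (g_e l hj)) (G_step j (g_e l hi)).
rewrite -!scalerAr !G_e (g_braided.1 i j) // /dsc !vl_swl_o; try lia.
rewrite !scalerDr !scalerA !addrA [LHS](ACl (1*3*2*4)) /=; congr (_ + _ *: _).
by rewrite mulrC.
Qed.

Lemma G_braid i : (0 < i)%N -> (i.+1 < n)%N -> G i * G i.+1 * G i = G i.+1 * G i * G i.+1.
Proof.
move=> i0 ij; have hi : (0 < i < n)%N by lia.
have hj : (0 < i.+1 < n)%N by lia.
have h0 : (0 < i <= n)%N by lia.
have h1 : (0 < i.+1 <= n)%N by lia.
have h2 : (0 < i.+2 <= n)%N by lia.
have o1 : sw i i.+2 = i.+2 by apply: sw_o; lia.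
have o2 : sw i.+1 i = i by apply: sw_o; lia.
have swE := (sw_l, sw_r, o1, o2).
apply: eq_on_e => l.
(* Both sides are expanded in words of g's applied to [e l]. The truth values record which
   corrections apply, and the equality term comes from the square of g_i. *)
have -> : G i * G i.+1 * G i * e l =
  g i * g i.+1 * g i * e l + (dl * (vl l i.+2 < vl l i.+1)%:R) *: (g i.+1 * g i * e l)
  + (dl * (vl l i.+1 < vl l i)%:R) *: (g i * g i.+1 * e l)
  + (dl ^+ 2 * ((vl l i.+2 < vl l i)%:R * ((vl l i == vl l i.+1)%:R + (vl l i < vl l i.+1)%:R)
       + (vl l i.+1 < vl l i)%:R * (vl l i.+2 < vl l i.+1)%:R)) *: (g i * e l)
  + (dl ^+ 2 * ((vl l i.+1 < vl l i)%:R * (vl l i.+2 < vl l i)%:R)) *: (g i.+1 * e l)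
  + (dl * (vl l i.+2 < vl l i)%:R
     + dl ^+ 3 * ((vl l i.+1 < vl l i)%:R * (vl l i.+2 < vl l i.+1)%:R)) *: e l.
  rewrite -!mulrA G_e mulrDr (G_step i.+1 (g_e l hi)) -scalerAr G_e.
  rewrite !(mulrDr (G i)) -!scalerAr (G_step i (g_g_e l hj hi)) (G_step i (g_e l hi)).
  rewrite mulrDr (G_step i (g_e l hj)) -scalerAr G_e gg_e //.
  rewrite /dsc.
  do 4?rewrite vl_swl ?swE //.
  do 4?rewrite vl_swl ?swE //.
  rewrite !scalerDr !scalerA !addrA.
  rewrite [LHS](ACl (1*2*6*(4*5*8)*7*(3*9))) /= -!scalerDl !mulrA.
  congr (_ + _ *: _ + _ *: _ + _ *: _ + _ *: _ + _ *: _); try by ring.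
  by case: (vl l i.+1 < vl l i)%N => /=; ring.
have -> : G i.+1 * G i * G i.+1 * e l =
  g i.+1 * g i * g i.+1 * e l + (dl * (vl l i.+2 < vl l i.+1)%:R) *: (g i.+1 * g i * e l)
  + (dl * (vl l i.+1 < vl l i)%:R) *: (g i * g i.+1 * e l)
  + (dl ^+ 2 * ((vl l i.+2 < vl l i.+1)%:R * (vl l i.+2 < vl l i)%:R)) *: (g i * e l)
  + (dl ^+ 2 * ((vl l i.+2 < vl l i)%:R * ((vl l i.+1 == vl l i.+2)%:R + (vl l i.+1 < vl l i.+2)%:R)
       + (vl l i.+2 < vl l i.+1)%:R * (vl l i.+1 < vl l i)%:R)) *: (g i.+1 * e l)
  + (dl * (vl l i.+2 < vl l i)%:R
     + dl ^+ 3 * ((vl l i.+1 < vl l i)%:R * (vl l i.+2 < vl l i.+1)%:R)) *: e l.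
  rewrite -!mulrA G_e mulrDr (G_step i (g_e l hj)) -scalerAr G_e.
  rewrite !(mulrDr (G i.+1)) -!scalerAr (G_step i.+1 (g_g_e l hi hj)) (G_step i.+1 (g_e l hj)).
  rewrite mulrDr (G_step i.+1 (g_e l hi)) -scalerAr G_e gg_e //.
  rewrite /dsc.
  do 4?rewrite vl_swl ?swE //.
  do 4?rewrite vl_swl ?swE //.
  rewrite !scalerDr !scalerA !addrA.
  rewrite [LHS](ACl (1*6*2*7*(4*5*8)*(3*9))) /= -!scalerDl !mulrA.
  congr (_ + _ *: _ + _ *: _ + _ *: _ + _ *: _ + _ *: _); try by ring.
  by case: (vl l i.+2 < vl l i.+1)%N => /=; ring.
(* The longest words agree by the braid relation; the coefficients are compared for each relative
   order of the three entries. *)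
rewrite (g_braided.2 i) //; congr (_ + _ *: _ + _ *: _ + _ *: _ + _ *: _ + _ *: _);
  case: (ltngtP (vl l i) (vl l i.+1)) => ab; case: (ltngtP (vl l i.+1) (vl l i.+2)) => bc;
  case: (ltngtP (vl l i) (vl l i.+2)) => ac /=; try (by ring); lia.
Qed.

Lemma G_braided : braided n G.
Proof. by split=> *; [apply: G_far|apply: G_braid]. Qed.

Lemma GK i : (0 < i < n)%N -> G i * (G i - dl%:A) = 1 /\ (G i - dl%:A) * G i = 1.
Proof.
move=> hi; have := G_quad hi; rewrite expr2 => h.
by rewrite mulrBr mulrBl h -scalerAr -scalerAl mulr1 mul1r addrK.
Qed.

(** The entry at place a+1 travels right to place a+k+1, past the entries between; for a = 0 and k =
    n-1 this is the full rotation. *)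
Fixpoint dsw a k l : Lam n r := if k is k'.+1 then swl (a + k) (dsw a k' l) else l.

Lemma desc_e a k l : (a + k < n)%N -> desc gf a k * e l = e (dsw a k l) * desc gf a k.
Proof.
elim: k => [|k IH] hk /=; first by rewrite mulr1 mul1r.
by rewrite -mulrA IH ?mulrA ?g_e //; lia.
Qed.

Lemma vl_dsw a k l j : (a + k < n)%N -> (0 < j <= n)%N -> vl (dsw a k l) j =
  if (j <= a)%N || (a + k.+1 < j)%N then vl l j
  else if j == (a + k.+1)%N then vl l a.+1 else vl l j.+1.
Proof.
elim: k j => [|k IH] j hk hj /=.
  case: ifP => // h; have -> : j = a.+1 by lia.
  by rewrite addn1 eqxx.
have hk' : (0 < a + k.+1 < n)%N by lia.
rewrite vl_swl //= IH ?sw_range //; try lia.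
rewrite /sw; case: (eqVneq j (a + k.+1)%N) => j1.
  by subst j; repeat case: ifP; try lia; move=> *; congr vl; lia.
case: (eqVneq j (a + k.+1).+1) => j2.
  by subst j; repeat case: ifP; try lia; move=> *; congr vl; lia.
by repeat case: ifP; lia.
Qed.

(** The travelling entry passes only entries at least as large, so no step meets a descent and no
    correction arises. *)
Lemma desc_G_asc a k l : (a + k < n)%N ->
  (forall j, (a.+1 < j <= a + k.+1)%N -> (vl l a.+1 <= vl l j)%N) ->
  desc G a k * e l = desc gf a k * e l.
Proof.
elim: k => [|k IH] hk hl //=.
rewrite -!mulrA IH; try lia; last by move=> j hj; apply: hl; lia.
rewrite desc_e; last by lia.
rewrite !mulrA G_asc // !vl_dsw; try lia.
have := hl (a + k.+2)%N ltac:(lia).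
rewrite (_ : (a + k.+1).+1 = (a + k.+2)%N); last by lia.
by repeat case: ifP; lia.
Qed.

(** Here the entry at place k+1 travels left past entries not exceeding it, again without meeting a
    descent. *)
Lemma asc_G_asc k l : (k < n)%N -> (forall j, (0 < j <= k)%N -> (vl l j <= vl l k.+1)%N) ->
  asc G k * e l = asc gf k * e l.
Proof.
elim: k l => [|k IH] l hk hl //=.
have hk' : (0 < k.+1 < n)%N by lia.
rewrite -!mulrA G_asc; last by apply: hl; lia.
rewrite g_e // !mulrA IH //; first by lia.
move=> j hj; rewrite vl_swl_l // vl_swl_o //; try lia.
by apply: hl; lia.
Qed.

Lemma jm_e j l : (0 < j <= n)%N -> jm gf X j * e l = e l * jm gf X j.
Proof.
elim: j l => // -[|j] IH l hj; first exact: X_e.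
rewrite jmS // -mulrA g_e ?mulrA; last by lia.
rewrite -(mulrA (g _)) IH; last by lia.
by rewrite !mulrA g_e ?swlK // ; lia.
Qed.

Definition rot := desc gf 0 n.-1 * X.

Lemma rot_e l : (0 < n)%N -> rot * e l = e (dsw 0 n.-1 l) * rot.
Proof. by move=> hn; rewrite -mulrA X_e mulrA desc_e ?mulrA //; lia. Qed.

(** Rotation moves the entries at i, i+1 to i-1, i, so the corrections on both sides are present for
    the same tuples. *)
Lemma rot_G i : (1 < i < n)%N -> rot * G i = G i.-1 * rot.
Proof.
move=> hi; have hn : (0 < n)%N by lia.
have n1 : (1 < n)%N by lia.
apply: eq_on_e => l; rewrite -[LHS]mulrA -[RHS]mulrA G_e mulrDr (G_step i.-1 (rot_e l hn)) mulrA.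
rewrite (rot_shift g_braided n1 gX_affine.1) // -scalerAr; congr (_ + _ *: _).
congr (_ * _%:R); rewrite /dsc !vl_dsw; try lia.
have -> : i.-1.+1 = i by lia.
by do 4?case: ifP; lia.
Qed.

(** One turn separates the entries at 1 and 2, as the first goes to the end; a second turn puts them
    at n-1 and n. *)
Lemma rot_rot_G : (1 < n)%N -> rot * rot * G 1 = G n.-1 * (rot * rot).
Proof.
move=> n1; have hn : (0 < n)%N by lia.
have re l : rot * rot * e l = e (dsw 0 n.-1 (dsw 0 n.-1 l)) * (rot * rot).
  by rewrite -[LHS]mulrA rot_e // [LHS]mulrA rot_e // -[LHS]mulrA.
apply: eq_on_e => l; rewrite -[LHS]mulrA -[RHS]mulrA G_e mulrDr (G_step n.-1 (re l)) mulrA.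
rewrite (rot_square_shift g_braided n1 gX_affine.1 (gX_affine.2 n1)) -scalerAr.
congr (_ + _ *: _); congr (_ * _%:R); rewrite /dsc.
have v m j : (0 < j <= n)%N -> vl (dsw 0 n.-1 m) j = if j == n then vl m 1 else vl m j.+1.
  by move=> hj; rewrite vl_dsw ?add0n ?prednK //; have -> : (j <= 0)%N || (n < j)%N = false by lia.
have e1 : vl (dsw 0 n.-1 (dsw 0 n.-1 l)) n.-1 = vl l 1.
  rewrite v; try lia; have -> : (n.-1 == n) = false by lia.
  by rewrite prednK // v ?eqxx ?hn ?leqnn.
have e2 : vl (dsw 0 n.-1 (dsw 0 n.-1 l)) n.-1.+1 = vl l 2.
  rewrite prednK // v ?eqxx ?hn ?leqnn //.
  by rewrite v; try lia; have -> : (1 == n)%N = false by lia.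
by rewrite e1 e2.
Qed.

Hypothesis hn : (0 < n)%N.

(** The affine relations come from those of the rotation. At a dominant tuple all corrections drop
    out of the elements concerned, which gives the plain formulas. *)
Lemma theta_exists : exists th : AG -> H, Arel n q qi th /\
  forall l, dominant l ->
    (forall i, (0 < i < n)%N -> vl l i = vl l i.+1 -> th (AT i) * e l = g i * e l) /\
    (forall j, (0 < j <= n)%N ->
       th (AZ j) * e l = jm gf X j * e l /\ th (AZi j) * e l = jm ginv Xi j * e l).
Proof.
pose Gi i := G i - dl%:A.
have GGi i : (0 < i < n)%N -> G i * Gi i = 1 /\ Gi i * G i = 1 by apply: GK.
have n1 : (0 + n.-1 < n)%N by lia.
have [ci [cK cVK]] := desc_inv GGi n1.
have [hi [hK hVK]] := desc_inv ginvK n1.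
have [XK1 XK2] := XK.
(* Forced by the requirement that T_(n-1) ... T_1 Z_1 be sent to [rot]. *)
pose Z1 := ci * rot; pose Z1i := Xi * hi * desc G 0 n.-1.
have ZK1 : Z1 * Z1i = 1.
  by rewrite /Z1 /Z1i /rot !mulrA -(mulrA _ X) XK1 mulr1 -(mulrA ci) hK mulr1 cVK.
have ZK2 : Z1i * Z1 = 1.
  rewrite /Z1 /Z1i /rot !mulrA -(mulrA _ _ ci) cK mulr1.
  by rewrite -(mulrA Xi) hVK mulr1.
have aZ : affine_braided n G Z1.
  split=> [i hi'|hn1].
    by apply: (unrot_comm G_braided _ cVK cK) => //; [lia|apply: rot_G].
  apply: (unrot_braid G_braided hn1 GGi cVK cK) => //; [exact: rot_G|exact: rot_rot_G].
have ZZ j : (0 < j <= n)%N ->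
    jm G Z1 j * jm Gi Z1i j = 1 /\ jm Gi Z1i j * jm G Z1 j = 1.
  move=> hj; split; apply: (jm_inv (n := n)) => //; try lia.
    by move=> i /GGi[].
  by move=> i /GGi[].
have XX j : (0 < j <= n)%N -> jm gf X j * jm ginv Xi j = 1 /\ jm ginv Xi j * jm gf X j = 1.
  move=> hj; split; apply: (jm_inv (n := n)) => //; try lia.
    by move=> i /ginvK[].
  by move=> i /ginvK[].
exists (fun x => match x with AT i => G i | AZ j => jm G Z1 j | AZi j => jm Gi Z1i j end).
split.
  split; first by move=> *; apply: G_far; lia.
  split; first by move=> *; apply: G_braid; lia.
  split; first by move=> *; apply: G_quad; lia.
  split; first by move=> j k hj hk; apply: (jm_comm G_braided aZ).
  split; first exact: ZZ.
  split=> [i j hi' hj j1 j2|i hi'].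
    have [ji|ij] : (j < i \/ i.+1 < j)%N by lia.
      by apply: (jm_comm_gt G_braided aZ); lia.
    by apply: (jm_comm_lt G_braided aZ); lia.
  by rewrite jmS //; lia.
move=> l dlm; split=> [i hi' eq|j hj].
  by rewrite G_asc // eq.
have Zj : jm G Z1 j * e l = jm gf X j * e l.
  case: j hj => // j hj.
  have hd : (j + (n.-1 - j) < n)%N by lia.
  have [d [_ dK]] := desc_inv GGi hd.
  (* The invertible factor G_(n-1) ... G_(j+1) completes the descending half of J_(j+1) to the full
     product, and [c * Z1] is [rot]. On the dominant tuple this factor and the ascending half act as
     with g's. *)
  suff h : desc G j (n.-1 - j) * (jm G Z1 j.+1 * e l) = desc G j (n.-1 - j) * (jm gf X j.+1 * e l).
    by rewrite -[LHS]mul1r -dK -mulrA h mulrA dK mul1r.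
  have hcat (F : nat -> H) : desc F j (n.-1 - j) * desc F 0 j = desc F 0 n.-1.
    by rewrite (desc_cat F 0 j); congr desc; lia.
  have dmono := dominant_mono dlm.
  rewrite jm_e // [RHS]mulrA desc_G_asc; try lia; last by move=> k hk; apply: dmono; lia.
  rewrite -[RHS]mulrA -jm_e // !jm_desc !mulrA hcat cK mul1r -!mulrA asc_G_asc //; last first.
    by move=> k hk; apply: dmono; lia.
  by rewrite /rot -hcat !mulrA.
split=> //.
have [z1 z2] := ZZ j hj; have [x1 x2] := XX j hj.
rewrite -[LHS]mulr1 -x1.
rewrite [LHS](_ : _ = jm Gi Z1i j * (e l * jm gf X j) * jm ginv Xi j); last by rewrite !mulrA.
rewrite -jm_e // -Zj !mulrA z2 mul1r.
by rewrite -[LHS]mul1r -x2 -mulrA [in LHS](mulrA (jm gf X j)) jm_e // -!mulrA x1 mulr1.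
Qed.

End HeckeH.

(** * Transport between the idempotents of an orbit *)

Section Transport.
Variables (n r : nat) (R : comNzRingType) (q qi : R) (H : algType R) (genH : HG n r -> H).
Hypothesis relH : Hrel q qi genH.
Local Notation g i := (genH (Hg n r i)).
Local Notation gf := (fun i => genH (Hg n r i)).
Local Notation e l := (genH (He l)).
Local Notation X := (genH (HX n r)).
Local Notation Xi := (genH (HXi n r)).
Local Notation ginv := (ginv q qi genH).
Implicit Types (l m : Lam n r) (i j k : nat).

Definition descent l := [pick p : 'I_n | (0 < p)%N && (vl l p.+1 < vl l p)%N].

(* [k] is fuel: [weight l] steps suffice to sort [l]. *)
Fixpoint gam k l : H :=
  if k isn't k'.+1 then e l else
  if descent l is Some p then g p * gam k' (swl p l) else e l.

Fixpoint gam' k l : H :=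
  if k isn't k'.+1 then e l else
  if descent l is Some p then gam' k' (swl p l) * g p else e l.

(** [gamma l] and [gamma' l] are mutually inverse between the idempotents of [lam0 l] and of [l];
    they identify all corners along an orbit. *)
Definition gamma l := gam (weight l) l.
Definition gamma' l := gam' (weight l) l.

Lemma descentP l : if descent l is Some p then (0 < p < n)%N /\ (vl l p.+1 < vl l p)%N
  else dominant l.
Proof.
rewrite /descent; case: pickP => [p /andP[p0 d]|h]; first by rewrite p0 /=.
apply: contraT => /not_dominant[i hi d]; have hi' : (i < n)%N by lia.
by have /= := h (Ordinal hi'); lia.
Qed.

Lemma gam_fuel k k' l : (weight l <= k)%N -> (weight l <= k')%N -> gam k l = gam k' l /\ gam' k l = gam' k' l.
Proof.
elim: k k' l => [|k IH] [|k'] l hk hk' //=; have := descentP l; case: descent => // p [hp d];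
  have w := weight_swl hp d; try lia.
by have [-> ->] := IH k' (swl p l) ltac:(lia) ltac:(lia).
Qed.

Lemma gammaE l : 
  (gamma l = if descent l is Some p then g p * gamma (swl p l) else e l) /\
  (gamma' l = if descent l is Some p then gamma' (swl p l) * g p else e l).
Proof.
have := descentP l; have [] := @gam_fuel (weight l).+1 (weight l) l; try lia.
rewrite /gamma /gamma' => <- <- /=; case: descent => // p [hp d].
have w := weight_swl hp d.
by have [-> ->] := @gam_fuel (weight l) (weight (swl p l)) (swl p l) ltac:(lia) ltac:(lia).
Qed.

Lemma gamma_dominant l : dominant l -> gamma l = e l /\ gamma' l = e l.
Proof.
move=> dl; have [-> ->] := gammaE l; have := descentP l; case: descent => // p [hp d].
by move/dominantP: dl => /(_ p hp); lia.
Qed.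

(* Newman's diamond argument: two descents of [l] are resolved by the braid relations. *)
Lemma gamma_desc l i : (0 < i < n)%N -> (vl l i.+1 < vl l i)%N -> gamma l = g i * gamma (swl i l).
Proof.
have [k] := ubnP (weight l); elim: k l i => // k IH l i lk hi d.
have [-> _] := gammaE l; have := descentP l; case: descent => [p [hp dp]|]; last first.
  by move/dominantP/(_ i hi); lia.
move: {p}(nat_of_ord p) hp dp => p hp dp.
wlog: i p hi d hp dp / (i <= p)%N.
  move=> wl; case: (leqP i p) => h; first exact: wl.
  by apply: esym; apply: wl => //; lia.
have wi := weight_swl hi d; have wp := weight_swl hp dp.
rewrite leq_eqVlt => /predU1P[<- //|]; rewrite leq_eqVlt => /predU1P[ip|ip].
  subst p.
  have o1 : sw i i.+2 = i.+2 by apply: sw_o; lia.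
  have o2 : sw i.+1 i = i by apply: sw_o; lia.
  have swE := (sw_l, sw_r, o1, o2).
  have h0 : (0 < i <= n)%N by lia.
  have h1 : (0 < i.+1 <= n)%N by lia.
  have h2 : (0 < i.+2 <= n)%N by lia.
  have d1 : (vl (swl i l) i.+2 < vl (swl i l) i.+1)%N by do 4?rewrite vl_swl ?swE //; lia.
  have d2 : (vl (swl i.+1 l) i.+1 < vl (swl i.+1 l) i)%N by do 4?rewrite vl_swl ?swE //; lia.
  have w1 := weight_swl hp d1; have w2 := weight_swl hi d2.
  have d3 : (vl (swl i.+1 (swl i l)) i.+1 < vl (swl i.+1 (swl i l)) i)%N.
    by do 4?rewrite vl_swl ?swE //; do 4?rewrite vl_swl ?swE //; lia.
  have d4 : (vl (swl i (swl i.+1 l)) i.+2 < vl (swl i (swl i.+1 l)) i.+1)%N.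
    by do 4?rewrite vl_swl ?swE //; do 4?rewrite vl_swl ?swE //; lia.
  rewrite (IH _ i.+1 _ _ d1) // ?(IH _ i _ _ d2) //; try lia.
  rewrite (IH _ i _ _ d3) // ?(IH _ i.+1 _ _ d4) //; try lia.
  have /= gg := (g_braided relH).2 i ltac:(lia) ltac:(lia).
  by rewrite !mulrA -swl_braid // gg.
have d1 : (vl (swl i l) p.+1 < vl (swl i l) p)%N by rewrite !vl_swl_o //; lia.
have d2 : (vl (swl p l) i.+1 < vl (swl p l) i)%N by rewrite !vl_swl_o //; lia.
rewrite (IH _ p _ _ d1) // ?(IH _ i _ _ d2) //; try lia.
have /= gg := (g_braided relH).1 i p ltac:(lia) ltac:(lia) ltac:(lia).
by rewrite !mulrA gg (@swl_comm n r i p) //; lia.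
Qed.

Lemma e_gamma l : e l * gamma l = gamma l.
Proof.
elim/sort_ind1: l => [l dl|l i hi d IH]; first by rewrite (gamma_dominant dl).1 (e_idem relH).
by rewrite (gamma_desc hi d) mulrA -{1}(swlK l hi) -(g_e relH) // -mulrA IH.
Qed.

Lemma gamma_e l : gamma l * e (lam0 l) = gamma l.
Proof.
elim/sort_ind1: l => [l dl|l i hi d IH].
  by rewrite (gamma_dominant dl).1 lam0_id // (e_idem relH).
by rewrite (gamma_desc hi d) -mulrA -(lam0_swl l hi) IH.
Qed.

Lemma gammaK l : gamma l * gamma' l = e l /\ gamma' l * gamma l = e (lam0 l).
Proof.
elim/sort_ind: l => l IH; have [] := gammaE l; have := descentP l.
case: descent => [p [hp d] -> ->|dl -> ->]; last by rewrite (e_idem relH) lam0_id.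
have [k1 k2] := IH p hp d.
have ne : vl (swl p l) p != vl (swl p l) p.+1 by rewrite vl_swl_l // vl_swl_r //; lia.
have sq := gg_e_neq relH hp ne.
split; last first.
  rewrite -[gamma (swl p l)]e_gamma !mulrA -(mulrA (gamma' _)) -(mulrA (gamma' _)) sq.
  by rewrite -mulrA e_gamma k2 lam0_swl.
rewrite mulrA -(mulrA (g p)) k1 (g_e relH) // swlK // -mulrA.
have ne' : vl l p != vl l p.+1 by lia.
by rewrite -[RHS](gg_e_neq relH hp ne') -[RHS]mulrA (g_e relH) // [RHS]mulrA (g_e relH) ?swlK // mulrA.
Qed.

Lemma gamma'_e l : gamma' l * e l = gamma' l.
Proof.
elim/sort_ind: l => l IH; have [_] := gammaE l; have := descentP l.
case: descent => [p [hp d] ->|dl ->]; last by rewrite (e_idem relH).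
by rewrite -mulrA (g_e relH) // mulrA IH.
Qed.

Lemma e_gamma' l : e (lam0 l) * gamma' l = gamma' l.
Proof.
elim/sort_ind: l => l IH; have [_] := gammaE l; have := descentP l.
case: descent => [p [hp d] ->|dl ->]; last by rewrite lam0_id // (e_idem relH).
by rewrite mulrA -(lam0_swl l hp) IH.
Qed.

Lemma gamma_swl i l : (0 < i < n)%N -> vl l i != vl l i.+1 -> g i * gamma l = gamma (swl i l).
Proof.
move=> hi ne; case: (ltngtP (vl l i) (vl l i.+1)) => h; last by rewrite h eqxx in ne.
  by rewrite (@gamma_desc (swl i l) i) ?vl_swl_l ?vl_swl_r ?swlK.
have ne' : vl (swl i l) i != vl (swl i l) i.+1 by rewrite vl_swl_l // vl_swl_r // eq_sym.
rewrite (gamma_desc hi h) -[gamma (swl i l)]e_gamma !mulrA.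
by rewrite (gg_e_neq relH hi ne').
Qed.

(** The generator is carried along the sorting: it commutes with a distant exchange and crosses an
    adjacent one by a braid relation. *)
Lemma g_gamma i l : (0 < i < n)%N -> vl l i = vl l i.+1 ->
  g i * gamma l = gamma l * g (st l i).
Proof.
have [k] := ubnP (weight l); elim: k l i => // k IH l i lk hi eq.
have [dl|/not_dominant[p hp d]] := boolP (dominant l).
  rewrite (gamma_dominant dl).1 st_dominant //; last by lia.
  by rewrite (g_e relH) //; have/eqP -> : swl i l == l by rewrite swl_fix // eq.
have w := weight_swl hp d.
have ne : vl l p != vl l p.+1 by lia.
have [far|adj] : ((i.+1 < p \/ p.+1 < i) \/ (p = i.+1 \/ i = p.+1))%N.
  by case: (eqVneq p i) => [pi|]; [subst p|]; lia.
  have gg : g i * g p = g p * g i.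
    by case: far => h; [|apply: esym]; apply: (g_braided relH).1; lia.
  rewrite (gamma_desc hp d) mulrA gg -!mulrA; congr (_ * _).
  by rewrite IH ?st_swl_o ?vl_swl_o //; lia.
(* The equal pair crosses the entry next to it in two sorting steps, smaller on its right or larger
   on its left, and one braid relation moves the generator across both. *)
case: adj => pi; subst.
  have o2 : sw i.+1 i = i by apply: sw_o; lia.
  have o1 : sw i i.+2 = i.+2 by apply: sw_o; lia.
  have swE := (sw_l, sw_r, o1, o2).
  have h0 : (0 < i <= n)%N by lia.
  have h1 : (0 < i.+1 <= n)%N by lia.
  have h2 : (0 < i.+2 <= n)%N by lia.
  have d1 : (vl (swl i.+1 l) i.+1 < vl (swl i.+1 l) i)%N.
    by do 4?rewrite vl_swl ?swE //; lia.
  have w1 := weight_swl hi d1.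
  have /= gg := (g_braided relH).2 i ltac:(lia) ltac:(lia).
  rewrite (gamma_desc hp d) (gamma_desc hi d1) !mulrA gg -!mulrA; congr (_ * (_ * _)).
  rewrite IH //; try lia.
    by rewrite st_swl ?sw_r ?st_swl ?o2 //; lia.
  do 4?rewrite vl_swl ?swE //; do 4?rewrite vl_swl ?swE //; lia.
have o2 : sw p.+1 p = p by apply: sw_o; lia.
have o1 : sw p p.+2 = p.+2 by apply: sw_o; lia.
have swE := (sw_l, sw_r, o1, o2).
have h0 : (0 < p <= n)%N by lia.
have h1 : (0 < p.+1 <= n)%N by lia.
have h2 : (0 < p.+2 <= n)%N by lia.
have d1 : (vl (swl p l) p.+2 < vl (swl p l) p.+1)%N.
  by do 4?rewrite vl_swl ?swE //; lia.
have w1 := weight_swl hi d1.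
have /= gg := (g_braided relH).2 p ltac:(lia) ltac:(lia).
rewrite (gamma_desc hp d) (gamma_desc hi d1) !mulrA -gg -!mulrA; congr (_ * (_ * _)).
rewrite IH //; try lia.
  by rewrite st_swl ?o2 ?st_swl ?sw_l //; lia.
do 4?rewrite vl_swl ?swE //; do 4?rewrite vl_swl ?swE //; lia.
Qed.

(** Between distinct entries g_i is an involution, so X_(i+1) = g_i X_i g_i becomes a plain
    conjugation and X_j just follows its entry through the sorting. *)
Lemma jm_gamma j l : (0 < j <= n)%N -> jm gf X j * gamma l = gamma l * jm gf X (st l j).
Proof.
have gB := g_braided relH; have gX := gX_affine relH.
elim/sort_ind1: l j => [l dl|l i hi d IH] j hj.
  by rewrite (gamma_dominant dl).1 st_dominant // (jm_e relH).
have ne : vl l i != vl l i.+1 by lia.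
have ne' : vl (swl i l) i != vl (swl i l) i.+1 by rewrite vl_swl_l // vl_swl_r //; lia.
have h0 : (0 < i <= n)%N by lia.
have h1 : (0 < i.+1 <= n)%N by lia.
have hs := sw_range hi hj.
have -> : st l j = st (swl i l) (sw i j) by rewrite st_swl // swK.
rewrite (gamma_desc hi d) -[RHS]mulrA -IH //.
(* [gamma (swl i l)] begins with this idempotent, so one exchange suffices. *)
suff h : jm gf X j * g i * e (swl i l) = g i * jm gf X (sw i j) * e (swl i l).
  by rewrite -[gamma _]e_gamma !mulrA h.
case: (eqVneq j i) => [->|j1].
  have cross : jm gf X i * g i * e (swl i l) = e l * (jm gf X i * g i).
    by rewrite -mulrA (g_e relH) // swlK // mulrA (jm_e relH) // mulrA.
  rewrite sw_l jmS //; last by lia.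
  transitivity (g i * g i * (jm gf X i * g i * e (swl i l))); last by rewrite !mulrA.
  by rewrite cross !mulrA (gg_e_neq relH hi ne).
case: (eqVneq j i.+1) => [->|j2].
  rewrite sw_r jmS //; last by lia.
  by rewrite -!mulrA (mulrA (g i) (g i) (e _)) (gg_e_neq relH hi ne').
rewrite sw_o //; congr (_ * _).
have [ji|ij] : (j < i \/ i.+1 < j)%N by lia.
  by apply: esym; apply: (jm_comm_gt gB gX); lia.
by apply: esym; apply: (jm_comm_lt gB gX); lia.
Qed.

Hypothesis hn : (0 < n)%N.

Lemma jmK j : (0 < j <= n)%N -> jm gf X j * jm ginv Xi j = 1 /\ jm ginv Xi j * jm gf X j = 1.
Proof.
have [x1 x2] := XK relH.
move=> hj; split; apply: (jm_inv (n := n)) => //; try lia.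
  by move=> i /(ginvK relH)[].
by move=> i /(ginvK relH)[].
Qed.

Lemma jmi_e j l : (0 < j <= n)%N -> jm ginv Xi j * e l = e l * jm ginv Xi j.
Proof.
move=> hj; have [x1 x2] := jmK hj.
by rewrite -[LHS]mulr1 -x1 mulrA -(mulrA _ (e l)) -(jm_e relH) // mulrA x2 mul1r.
Qed.

Lemma Xi_gamma l : Xi * gamma l = gamma l * jm ginv Xi (st l 1).
Proof.
have [x1 x2] := XK relH; have [JK _] := jmK (@st_range n r l 1%N hn).
have := @jm_gamma 1%N l hn; rewrite /= => h.
by rewrite -[LHS]mulr1 -JK mulrA -(mulrA Xi) -h mulrA x2 mul1r.
Qed.

End Transport.

(** * Block decomposition *)

Section SubalgClosure.
Variables (n r : nat) (R : comNzRingType) (A : algType R) (genA : AG -> A) (l : Lam n r).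

Lemma Hlam1 : in_Hlam genA l 1.
Proof. by move=> P P1. Qed.

Lemma Hlam_lin a u v : in_Hlam genA l u -> in_Hlam genA l v -> in_Hlam genA l (a *: u + v).
Proof. by move=> hu hv P P1 Pl PM Pg; apply: (Pl); [apply: hu|apply: hv]. Qed.

Lemma HlamM u v : in_Hlam genA l u -> in_Hlam genA l v -> in_Hlam genA l (u * v).
Proof. by move=> hu hv P P1 Pl PM Pg; apply: (PM); [apply: hu|apply: hv]. Qed.

Lemma Hlam0 : in_Hlam genA l 0.
Proof. by have := Hlam_lin (-1) Hlam1 Hlam1; rewrite scaleN1r addNr. Qed.

Lemma HlamD u v : in_Hlam genA l u -> in_Hlam genA l v -> in_Hlam genA l (u + v).
Proof. by move=> hu hv; rewrite -[u]scale1r; apply: Hlam_lin. Qed.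

Lemma Hlam_sum (I : finType) (F : I -> A) :
  (forall i, in_Hlam genA l (F i)) -> in_Hlam genA l (\sum_i F i).
Proof. by move=> h; apply: (big_ind (in_Hlam genA l)) => //; [apply: Hlam0|apply: HlamD]. Qed.

Lemma Hlam_generator x : Hlam_gen genA l x -> in_Hlam genA l x.
Proof. by move=> hx P P1 Pl PM; apply. Qed.

End SubalgClosure.

Section BlockDecomposition.
Variables (n r : nat) (hn : (0 < n)%N) (l0 : Lam n r) (R : comNzRingType) (q qi : R).
Variables (H : algType R) (genH : HG n r -> H).
Hypothesis HH : presents (@Hvalid n r) (Hrel q qi) genH.
Variables (A : algType R) (genA : AG -> A).
Hypothesis relA : Arel n q qi genA.
Variables (rho : {lrmorphism H -> ffmx A l0}) (theta : {lrmorphism A -> H}).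
Let relH := HH.1.
Local Notation g i := (genH (Hg n r i)).
Local Notation gf := (fun i => genH (Hg n r i)).
Local Notation e l := (genH (He l)).
Local Notation X := (genH (HX n r)).
Local Notation Xi := (genH (HXi n r)).
Local Notation T i := (genA (AT i)).
Local Notation Z i := (genA (AZ i)).
Local Notation Zi i := (genA (AZi i)).
Local Notation ginv := (ginv q qi genH).
Local Notation gamma := (gamma genH).
Local Notation gamma' := (gamma' genH).
Hypothesis rhoE : forall x, Hvalid x -> rho (genH x) = model l0 genA x.
Hypothesis thetaT : forall l i, dominant l -> (0 < i < n)%N -> vl l i = vl l i.+1 ->
  theta (T i) * e l = g i * e l.
Hypothesis thetaZ : forall l j, dominant l -> (0 < j <= n)%N ->
  theta (Z j) * e l = jm gf X j * e l /\ theta (Zi j) * e l = jm ginv Xi j * e l.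
Implicit Types (l m : Lam n r) (i j k : nat) (x y : H).

Lemma H_ind (P : H -> Prop) :
  (P 1) -> (forall a u v, P u -> P v -> P (a *: u + v)) -> (forall u v, P u -> P v -> P (u * v)) ->
  (forall i, (0 < i < n)%N -> P (g i)) -> (forall l, P (e l)) -> P X -> P Xi -> forall x, P x.
Proof.
move=> P1 Pl PM Pg Pe PX PXi; apply: (presents_ind P1 Pl PM HH); last first.
  by case=> [i|l||] //= hi; apply: Pg; lia.
move=> B f G injf fG.
have fg i : (0 < i < n)%N -> f (G (Hg n r i)) = g i by move=> hi; apply: fG => /=; lia.
have fe l : f (G (He l)) = e l by apply: fG.
have fX : f (G (HX n r)) = X by apply: fG.
have fXi : f (G (HXi n r)) = Xi by apply: fG.
split; first by move=> i j i0 ij jn; apply: injf; rewrite !rmorphM /= !fg; try lia; apply: relH.1.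
split; first by move=> i i0 ij; apply: injf; rewrite !rmorphM /= !fg; try lia; apply: relH.2.1.
split; first by move=> i l hi; apply: injf; rewrite !rmorphM /= !fg ?fe; try lia; apply: relH.2.2.1.
split.
  apply: injf; rewrite rmorph1 raddf_sum -(sum_e relH).
  by apply: eq_bigr => l _; apply: fe.
split.
  move=> l l'; apply: injf; rewrite rmorphM /= !fe (e_orthogonal relH).
  by case: eqP; rewrite ?fe ?rmorph0.
split.
  move=> i hi; apply: injf; rewrite rmorphXn rmorphD rmorph1 /= linearZ_LR raddf_sum /= fg; last by lia.
  rewrite (g_sq relH); last by lia.
  by congr (_ + _ *: _); apply: eq_bigr => l _; rewrite rmorphM /= fg ?fe //; lia.
have [x1 x2] := XK relH.
split; first by split; apply: injf; rewrite rmorphM rmorph1 /= fX fXi.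
split; first by move=> n1; apply: injf; rewrite !rmorphM /= !fX !fg //; apply: (gX_affine relH).2.
split.
  by move=> i hi; apply: injf; rewrite !rmorphM /= !fX !fg; try lia; apply: (gX_affine relH).1; lia.
by move=> l; apply: injf; rewrite !rmorphM /= fX fe (X_e relH).
Qed.

Lemma Hlam_T l i : (0 < i < n)%N -> vl l i = vl l i.+1 -> in_Hlam genA (lam0 l) (T (st l i)).
Proof.
move=> hi eq; have hs := st_fix_range hi eq.
apply: Hlam_generator; right; exists (st l i); split=> //; first by lia.
by rewrite swl_fix // -stS // !vl_lam0_st ?eq //; lia.
Qed.

Lemma Hlam_Z l j : (0 < j <= n)%N ->
  in_Hlam genA l (Z j) /\ in_Hlam genA l (Zi j).
Proof. by move=> hj; split; apply: Hlam_generator; left; exists j; split; auto. Qed.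

(** In general [theta] mixes idempotents. On the generators of H_l, applied to [e l], it agrees with
    g_i fixing l or with X_j and its inverse, all of which preserve [e l]. *)
Lemma theta_stab l h : dominant l -> in_Hlam genA l h -> theta h * e l = e l * (theta h * e l).
Proof.
move=> dl hh; apply: (hh (fun h => theta h * e l = e l * (theta h * e l))) 
  => {h hh} [|a u v hu hv|u v hu hv|h].
- by rewrite rmorph1 mul1r (e_idem relH).
- by rewrite linearP mulrDl mulrDr -scalerAl -scalerAr -hu -hv.
- by rewrite rmorphM -(mulrA (theta u)) hv (mulrA (theta u)) hu !mulrA (e_idem relH).
case=> [[j [hj [->|->]]]|[i [hi fl ->]]].
- by rewrite (thetaZ dl hj).1 (jm_e relH) // mulrA (e_idem relH).
- by rewrite (thetaZ dl hj).2 (jmi_e relH hn) // mulrA (e_idem relH).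
have hi' : (0 < i < n)%N by lia.
rewrite thetaT //; last by apply/eqP; rewrite -swl_fix.
by rewrite (g_e relH) // (eqP fl) mulrA (e_idem relH).
Qed.

Lemma rho_e l m (p : Lam n r) x :
  rho (x * e l) (m, p) = if p == l then rho x (m, p) else 0.
Proof.
rewrite rmorphM /= rhoE // ffmxM (bigD1 p) //= ffunE /= eqxx big1 ?addr0.
  by case: eqP; rewrite ?mulr1 ?mulr0.
by move=> i ik; rewrite ffunE /= (negPf ik) mulr0.
Qed.

Lemma rho_jm j : (0 < j <= n)%N -> rho (jm gf X j) = monomial l0 id (fun p => Z (st p j)).
Proof.
move=> hj; rewrite -(model_jm hn l0 relA hj).
elim: j hj => // -[|j] IH hj; first by rewrite rhoE.
rewrite !(jmS _ _ (ltn0Sn j)) -IH; last by lia.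
by rewrite !rmorphM /= rhoE //=; lia.
Qed.

Lemma rho_jmi j : (0 < j <= n)%N -> rho (jm ginv Xi j) = monomial l0 id (fun p => Zi (st p j)).
Proof.
move=> hj; have [x1 x2] := jmK relH hn hj.
have ZK : monomial l0 id (fun p => Z (st p j)) * monomial l0 id (fun p => Zi (st p j)) = 1.
  rewrite monomialM monomial1; apply: eq_monomial => // y.
  by have [] := A_ZK relA (st_range y hj).
rewrite -[LHS]mulr1 -ZK mulrA -rho_jm // -rmorphM x2 rmorph1 mul1r.
by [].
Qed.

(** Holds on generators and passes to products: by [theta_stab] an [e l] can be inserted between the
    factors, which leaves one term of the matrix product. Membership is carried through the
    induction for this reason. *)
Lemma rho_theta l h : dominant l -> in_Hlam genA l h -> rho (theta h * e l) (l, l) = h.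
Proof.
move=> dl hh; have stab u := @theta_stab l u dl.
suff [_ ->] : in_Hlam genA l h /\ rho (theta h * e l) (l, l) = h by [].
apply: (hh (fun h => in_Hlam genA l h /\ rho (theta h * e l) (l, l) = h))
  => {h hh} [|a u v [hu eu] [hv ev]|u v [hu eu] [hv ev]|h hh].
- by split; [apply: Hlam1|rewrite rmorph1 mul1r -[e l]mul1r rho_e eqxx rmorph1 ffmx1 eqxx].
- split; first exact: Hlam_lin.
  by rewrite linearP mulrDl -scalerAl linearP ffunE ffmxZ eu ev.
- split; first exact: HlamM.
  rewrite [theta _]rmorphM /= -mulrA stab // mulrA rmorphM /= ffmxM.
  rewrite (bigD1 l) //= eu ev big1 ?addr0 // => k kl.
  by rewrite rho_e (negPf kl) mul0r.
split; first exact: Hlam_generator.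
case: hh => [[j [hj [->|->]]]|[i [hi fl ->]]].
- by rewrite (thetaZ dl hj).1 rho_e eqxx rho_jm // ffunE /= eqxx st_dominant.
- by rewrite (thetaZ dl hj).2 rho_e eqxx rho_jmi // ffunE /= eqxx st_dominant.
have hi' : (0 < i < n)%N by lia.
have eq : vl l i = vl l i.+1 by apply/eqP; rewrite -swl_fix.
rewrite thetaT // rho_e eqxx rhoE /= ?ffunE /=; last by lia.
by rewrite eq_sym fl /coef eq eqxx st_dominant //; lia.
Qed.

(** The last clause recovers a block from one matrix entry and does the work of a basis theorem; the
    first two make the property pass to products. *)
Definition blockwise x := forall m l,
  [/\ in_Hlam genA (lam0 l) (rho x (m, l)),
      m \notin orbW l -> rho x (m, l) = 0
    & e m * x * e l = gamma m * theta (rho x (m, l)) * gamma' l].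

Lemma blockwise_monomial x (f : Lam n r -> Lam n r) (a : Lam n r -> A) :
  (forall l, f l \in orbW l) -> rho x = monomial l0 f a ->
  (forall l, in_Hlam genA (lam0 l) (a l)) ->
  (forall l, x * e l = gamma (f l) * theta (a l) * gamma' l) -> blockwise x.
Proof.
move=> fo rx ha hx m l; rewrite rx ffunE /=; split.
- by case: eqP => // _; apply: Hlam0.
- by case: eqP => // ->; rewrite fo.
rewrite -mulrA hx !mulrA; case: eqP => [->|ne]; first by rewrite (e_gamma relH).
rewrite rmorph0 mulr0 mul0r -(e_gamma relH (f l)) mulrA (e_orthogonal relH).
by case: eqP ne => // _ _; rewrite !mul0r.
Qed.

Lemma blockwiseM x y : blockwise x -> blockwise y -> blockwise (x * y).
Proof.
move=> hx hy m l; rewrite rmorphM /= ffmxM; split.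
- apply: Hlam_sum => k; have [hk k0 _] := hy k l.
  case: (boolP (k \in orbW l)) => ko; last by rewrite k0 // mulr0; apply: Hlam0.
  by apply: HlamM => //; rewrite -(lam0_orb ko); case: (hx m k).
- move=> ml; apply: big1 => k _; have [_ k0 _] := hy k l.
  case: (boolP (k \in orbW l)) => ko; last by rewrite k0 // mulr0.
  have [_ -> //] := hx m k; first by rewrite mul0r.
  by apply: contra ml => mk; apply: orbW_trans mk.
rewrite raddf_sum mulr_sumr mulr_suml /=.
(* Inserting the sum of the idempotents mirrors matrix multiplication. The inner
   [gamma' k * gamma k] becomes an idempotent of the dominant tuple, absorbed by stability. *)
transitivity (\sum_(p : Lam n r) (e m * x * e p) * (e p * y * e l)).
  have -> : e m * (x * y) * e l = e m * x * (\sum_(p : Lam n r) e p) * y * e l.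
    by rewrite (sum_e relH) mulr1 !mulrA.
  rewrite mulr_sumr !mulr_suml; apply: eq_bigr => k _.
  by rewrite !mulrA -(mulrA _ (e k) (e k)) (e_idem relH).
apply: eq_bigr => k _; have [hk k0 ->] := hy k l; have [_ _ ->] := hx m k.
case: (boolP (k \in orbW l)) => ko; last by rewrite k0 // mulr0 !rmorph0 !(mulr0, mul0r).
rewrite !mulrA -(mulrA _ (gamma' k)) (gammaK relH k).2 (lam0_orb ko) rmorphM !mulrA.
have st := theta_stab (lam0P l).1 hk.
rewrite -(e_gamma' relH l) !mulrA; congr (_ * _).
rewrite -[LHS]mulrA -[in LHS](mulrA _ (e _)) -[RHS]mulrA; congr (_ * _).
by rewrite -st.
Qed.

Lemma all_blockwise x : blockwise x.
Proof.
have h1 : (0 < 1 <= n)%N := hn; elim/H_ind: x.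
- apply: (@blockwise_monomial 1 id (fun=> 1)); first exact: orbW_refl.
  + by rewrite rmorph1 monomial1.
  + by move=> l; apply: Hlam1.
  by move=> l; rewrite mul1r rmorph1 mulr1 (gammaK relH l).1.
- move=> a u v hu hv m l; have [iu u0 eu] := hu m l; have [iv v0 ev] := hv m l.
  rewrite linearP ffunE ffmxZ; split; first exact: Hlam_lin.
    by move=> ml; rewrite u0 // v0 // scaler0 addr0.
  by rewrite linearP !mulrDr !mulrDl -!scalerAr -!scalerAl eu ev.
- exact: blockwiseM.
- move=> i hi; apply: (@blockwise_monomial _ (swl i) (coef genA i)).
  + by move=> l; apply: swl_orbW.
  + by rewrite rhoE //=; lia.
  + by move=> l; rewrite /coef; case: eqP => eq; [apply: Hlam_T|apply: Hlam1].
  move=> l; rewrite /coef; case: eqVneq => eq; last first.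
    by rewrite rmorph1 mulr1 -(gamma_swl relH) // -mulrA (gammaK relH l).1.
  (* Between equal entries [g i] is carried through [gamma l] to the dominant tuple, where it
     coincides with the image of T at the place [st l i]. *)
  have/eqP -> : swl i l == l by rewrite swl_fix // eq.
  rewrite -(gammaK relH l).1 mulrA (g_gamma relH) // -(e_gamma' relH l) -!mulrA; congr (_ * _).
  rewrite !mulrA; congr (_ * _); rewrite thetaT ?(lam0P l).1 //; first exact: st_fix_range.
  by rewrite -stS // !vl_lam0_st ?eq //; lia.
- move=> l; apply: (@blockwise_monomial _ id (fun p => (p == l)%:R)); first exact: orbW_refl.
  + by rewrite rhoE.
  + by move=> m; case: eqP => _; [apply: Hlam1|apply: Hlam0].
  move=> m; rewrite (e_orthogonal relH) [l == m]eq_sym; case: eqP => [->|_].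
    by rewrite rmorph1 mulr1 (gammaK relH l).1.
  by rewrite rmorph0 mulr0 mul0r.
- apply: (@blockwise_monomial _ id (fun p => Z (st p 1))); first exact: orbW_refl.
  + by rewrite rhoE.
  + by move=> l; case: (Hlam_Z (lam0 l) (st_range l h1)).
  move=> l; rewrite -(gammaK relH l).1 mulrA (@jm_gamma _ _ _ _ _ _ _ relH 1%N) //.
  rewrite -(e_gamma' relH l) -!mulrA; congr (_ * _); rewrite !mulrA; congr (_ * _).
  by rewrite (thetaZ (lam0P l).1 (st_range l h1)).1.
- apply: (@blockwise_monomial _ id (fun p => Zi (st p 1))); first exact: orbW_refl.
  + by rewrite rhoE.
  + by move=> l; case: (Hlam_Z (lam0 l) (st_range l h1)).
  move=> l; rewrite -(gammaK relH l).1 mulrA (Xi_gamma relH hn).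
  rewrite -(e_gamma' relH l) -!mulrA; congr (_ * _); rewrite !mulrA; congr (_ * _).
  by rewrite (thetaZ (lam0P l).1 (st_range l h1)).2.
Qed.

End BlockDecomposition.

(** * The Yokonuma-Hecke algebra *)

Section RootOfUnity.
Variables (r : nat) (hr : (0 < r)%N) (R : comNzRingType) (z : R).
Hypothesis hz : root (map_poly intr 'Phi_r) z.

(** An integer polynomial vanishing at a primitive complex root is divisible by the cyclotomic
    polynomial over the integers, hence vanishes at [z] in any commutative ring. *)
Lemma cyclotomic_root (p : {poly int}) (w : algC) : r.-primitive_root w ->
  root (map_poly intr p) w -> root (map_poly intr p) z.
Proof.
move=> pw pr; have [pf [Dpf mpf] dv] := minCpolyP w.
have eqf : pf = map_poly intr 'Phi_r.
  apply: (map_poly_inj (ratr : {rmorphism rat -> algC})).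
  rewrite -Dpf (minCpoly_cyclotomic pw) -(Cintr_Cyclotomic pw) -map_poly_comp.
  by apply: eq_map_poly => a; rewrite /= ratr_int.
have : 'Phi_r %| p.
  rewrite -dvdp_rat_int -eqf -dv -map_poly_comp.
  by rewrite (eq_map_poly (g := intr)) // => a; rewrite /= ratr_int.
move/(Pdiv.IdomainMonic.dvdpP (Cyclotomic_monic r)) => [d ->].
by rewrite rmorphM /= /root hornerM (eqP hz) mulr0.
Qed.

Lemma zX : z ^+ r = 1.
Proof.
have [w pw] := C_prim_root_exists hr.
have := @cyclotomic_root ('X^r - 1) w pw.
rewrite !rmorphB !rmorph1 /= !map_polyXn /root !hornerE (prim_expr_order pw) subrr eqxx.
by rewrite subr_eq0 => /(_ isT)/eqP.
Qed.

Lemma sum_zX k : \sum_(s < r) z ^+ (k * s) = if (r %| k)%N then r%:R else 0.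
Proof.
case: ifP => rk.
  case/dvdnP: rk => d ->.
  rewrite (eq_bigr (fun=> 1)) => [|s _]; first by rewrite sumr_const card_ord.
  by rewrite mulnAC mulnC exprM zX expr1n.
have [w pw] := C_prim_root_exists hr.
have := @cyclotomic_root (\sum_(s < r) 'X^(k * s)) w pw.
have E (S : comNzRingType) (y : S) : (map_poly intr (\sum_(s < r) 'X^(k * s) : {poly int})).[y]
    = \sum_(s < r) y ^+ (k * s).
  rewrite rmorph_sum horner_sum; apply: eq_bigr => s _.
  by rewrite /= map_polyXn hornerXn.
rewrite /root !E => h; apply/eqP/h; apply/eqP.
have : (w ^+ k - 1) * (\sum_(s < r) w ^+ (k * s)) = 0.
  under eq_bigr => s _ do rewrite exprM.
  by rewrite -subrX1 -exprM mulnC exprM (prim_expr_order pw) expr1n subrr.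
move/eqP; rewrite mulf_eq0 subr_eq0 -(prim_order_dvd pw) rk /=.
by move/eqP.
Qed.

End RootOfUnity.

Lemma sum_shift (V : nmodType) (f : nat -> V) r : f r = f 0%N ->
  \sum_(s < r) f s.+1 = \sum_(s < r) f s.
Proof.
case: r => [|r] e; first by rewrite !big_ord0.
by rewrite big_ord_recr big_ord_recl /= addrC e.
Qed.

Section WeightIdempotents.
Variables (n r : nat) (hr : (0 < r)%N) (R : comNzRingType) (z ri : R).
Hypotheses (hri : r%:R * ri = 1) (hz : root (map_poly intr 'Phi_r) z).
Variables (B : algType R) (t : nat -> B).
Hypothesis tC : forall i j, (0 < i <= n)%N -> (0 < j <= n)%N -> t i * t j = t j * t i.
Hypothesis tr : forall i, (0 < i <= n)%N -> t i ^+ r = 1.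
Implicit Types (l m : Lam n r) (v y : B).

Definition eigen (i : nat) (a : nat) v := t i * v = z ^+ a *: v.

(** With natural exponents, [r.-1 * a] plays the role of -a modulo r. *)
Lemma dvd_pred_mul a b : (a < r)%N -> (b < r)%N -> (r %| r.-1 * a + b)%N = (a == b).
Proof.
move=> ar br; have -> : ((r %| r.-1 * a + b) = (r.-1 * a + b + a == a %[mod r]))%N.
  by have := eqn_modDr a (r.-1 * a + b) 0 r; rewrite add0n mod0n => ->.
have -> : (r.-1 * a + b + a = a * r + b)%N by nia.
by rewrite modnMDl !modn_small // eq_sym.
Qed.

Lemma eigenX i a v s : eigen i a v -> t i ^+ s * v = z ^+ (a * s) *: v.
Proof.
move=> h; elim: s => [|s IH]; first by rewrite mul1r muln0 scale1r.
by rewrite exprS -mulrA IH -scalerAr h scalerA -exprD mulnS addnC.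
Qed.

Lemma sum_char (a b : nat) : (a < r)%N -> (b < r)%N ->
  ri * \sum_(s < r) z ^+ ((r.-1 * a + b) * s) = (a == b)%:R.
Proof.
move=> ar br; rewrite sum_zX // dvd_pred_mul //.
by case: eqP; rewrite ?mulr0 // mulrC.
Qed.

Lemma eigen_e i a b v : (a < r)%N -> (b < r)%N -> eigen i a v -> eigen i.+1 b v ->
  (ri *: \sum_(s < r) (t i ^+ s * (t i.+1 ^+ r.-1) ^+ s)) * v = (a == b)%:R *: v.
Proof.
move=> ar br ea eb; rewrite -scalerAl mulr_suml eq_sym -(sum_char br ar) mulr_sumr scaler_suml scaler_sumr.
apply: eq_bigr => s _; rewrite -exprM -mulrA (eigenX _ eb) -scalerAr (eigenX _ ea) !scalerA -mulrA -exprD.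
by congr (_ * z ^+ _ *: _); nia.
Qed.

(** The discrete Fourier projection onto the eigenspace of t_j for z^a. *)
Definition char_idem j (a : nat) := ri *: \sum_(s < r) z ^+ (r.-1 * a * s) *: t j ^+ s.

Lemma char_idem_eigen j a b v : (a < r)%N -> (b < r)%N -> eigen j b v ->
  char_idem j a * v = (a == b)%:R *: v.
Proof.
move=> ar br ev; rewrite /char_idem -scalerAl mulr_suml -(sum_char ar br) mulr_sumr scaler_suml scaler_sumr.
apply: eq_bigr => s _; rewrite -scalerAl (eigenX _ ev) !scalerA -mulrA -exprD.
by rewrite mulnDl.
Qed.

Lemma eigen_char_idem j a : (0 < j <= n)%N -> (a < r)%N -> eigen j a (char_idem j a).
Proof.
move=> hj ar; rewrite /eigen /char_idem -scalerAr scalerA mulrC -scalerA; congr (_ *: _).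
pose f s := z ^+ (r.-1 * a * s) *: t j ^+ s.
have fS s : z ^+ a *: f s.+1 = t j * f s.
  rewrite /f scalerA -exprD -scalerAr -exprS; congr (_ *: _).
  have -> : (a + r.-1 * a * s.+1 = r * a + r.-1 * a * s)%N by nia.
  by rewrite exprD exprM (zX hr hz) expr1n mul1r.
have e : \sum_(s < r) f s.+1 = \sum_(s < r) f s.
  apply: sum_shift; rewrite /f tr // muln0 !expr0 mulnC exprM (zX hr hz).
  by rewrite expr1n.
rewrite -[in RHS]e mulr_sumr scaler_sumr.
by apply: eq_bigr => s _; rewrite fS.
Qed.

Lemma sum_char_idem j : \sum_(a < r) char_idem j a = 1.
Proof.
rewrite -scaler_sumr exchange_big /=.
under eq_bigr => s _ do rewrite -scaler_suml.
rewrite (bigD1 (Ordinal hr)) //= [X in _ + X]big1 ?addr0.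
  rewrite (eq_bigr (fun=> 1)) => [|a _]; last by rewrite /= muln0.
  by rewrite sumr_const card_ord expr0 scalerA mulrC hri scale1r.
move=> s s0; under eq_bigr => a _ do rewrite mulnAC.
rewrite sum_zX // -[(_ * s)%N]addn0 dvd_pred_mul // ifF ?scale0r //.
by apply/negbTE; move: s0; rewrite -val_eqE.
Qed.

Definition weight_idem l := \prod_(p < n) char_idem p.+1 (l p).

Definition weight_vector l v := forall p : 'I_n, eigen p.+1 (l p) v.

Lemma weight_idem_eigen l m v : weight_vector m v -> weight_idem l * v = (l == m)%:R *: v.
Proof.
move=> hv.
have -> : (l == m) = \big[andb/true]_(p < n) (l p == m p).
  rewrite big_andE; apply/eqP/forallP => [-> p|h]; first by rewrite eqxx.
  by apply/ffunP=> p; apply/eqP; apply: h.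
rewrite /weight_idem; apply: (big_ind2 (fun x (b : bool) => x * v = b%:R *: v)).
- by rewrite mul1r scale1r.
- by move=> x b y c hx hy; rewrite -mulrA hy -scalerAr hx scalerA mulrC -natrM mulnb.
by move=> p _; rewrite (char_idem_eigen (ltn_ord _) (ltn_ord _) (hv p)).
Qed.

Lemma weight_vector_weight_idem l : weight_vector l (weight_idem l).
Proof.
move=> p; rewrite /eigen /weight_idem; have : p \in index_enum 'I_n by rewrite mem_index_enum.
elim: (index_enum _) => // k s IH; rewrite big_cons in_cons.
case: (eqVneq p k) => [-> _|pk /= /IH h].
  have h : t k.+1 * char_idem k.+1 (l k) = z ^+ l k *: char_idem k.+1 (l k).
    by apply: eigen_char_idem; apply: ltn_ord.
  by rewrite mulrA h -scalerAl.
rewrite mulrA; have -> : t p.+1 * char_idem k.+1 (l k) = char_idem k.+1 (l k) * t p.+1.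
  rewrite /char_idem -scalerAr -scalerAl mulr_sumr mulr_suml; congr (_ *: _).
  apply: eq_bigr => a _; rewrite -scalerAr -scalerAl; congr (_ *: _).
  by apply: (commrX a); apply: tC; apply: ltn_ord.
by rewrite -mulrA h -scalerAr.
Qed.

Lemma sum_weight_idem : \sum_l weight_idem l = 1.
Proof.
rewrite /weight_idem -(bigA_distr_bigA (fun (p : 'I_n) (a : 'I_r) => char_idem p.+1 a)).
by apply: big1 => p _; apply: sum_char_idem.
Qed.

Lemma weight_idemM l m : weight_idem l * weight_idem m = if l == m then weight_idem l else 0.
Proof.
rewrite (weight_idem_eigen _ (weight_vector_weight_idem m)).
by case: eqP => [->|_]; rewrite ?scale1r ?scale0r.
Qed.

(** Since [y] maps each weight space m into the weight space f m, inserting the sum of the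
    projections on the right leaves a single term. *)
Lemma weight_idem_intertwine y (f : Lam n r -> Lam n r) l : injective f ->
  (forall m, weight_vector (f m) (y * weight_idem m)) -> y * weight_idem l = weight_idem (f l) * y.
Proof.
move=> finj fw.
rewrite -[RHS]mulr1 -sum_weight_idem mulr_sumr (bigD1 l) //= big1 ?addr0 => [|m ml].
  by rewrite -mulrA (weight_idem_eigen _ (fw l)) eqxx scale1r.
by rewrite -mulrA (weight_idem_eigen _ (fw m)) (inj_eq finj) eq_sym (negPf ml) scale0r.
Qed.

End WeightIdempotents.

Section YokonumaHecke.
Variables (r n : nat) (hr : (0 < r)%N) (hn : (0 < n)%N).
Variables (R : comNzRingType) (q qi z ri : R).
Hypotheses (hri : r%:R * ri = 1) (hz : root (map_poly intr 'Phi_r) z).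
Variables (Y : algType R) (genY : YG -> Y).
Hypothesis HY : presents (Yvalid n) (Yrel r n q qi ri) genY.
Variables (H : algType R) (genH : HG n r -> H).
Hypothesis HH : presents (@Hvalid n r) (Hrel q qi) genH.
Let relH := HH.1.
Implicit Types (l m : Lam n r) (i j k : nat).
Local Notation g i := (genH (Hg n r i)).
Local Notation e l := (genH (He l)).
Local Notation X := (genH (HX n r)).
Local Notation Xi := (genH (HXi n r)).

(** The image of t_j, given by its spectral decomposition; it inverts the Fourier projections. *)
Definition char_t j : H := \sum_l z ^+ vl l j *: e l.

Lemma eigen_char_t j l : eigen z char_t j (vl l j) (e l).
Proof.
rewrite /eigen /char_t mulr_suml (bigD1 l) //= -scalerAl (e_idem relH) big1 ?addr0 // => m ml.
by rewrite -scalerAl (e_orthogonal relH) (negPf ml) scaler0.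
Qed.

Definition Y_to_H (x : YG) : H :=
  match x with Yt j => char_t j | Yh i => g i | YY => X | YYi => Xi end.

Lemma char_t_comm i j : char_t i * char_t j = char_t j * char_t i.
Proof.
apply: (eq_on_e relH) => l; rewrite -!mulrA !eigen_char_t -!scalerAr !eigen_char_t !scalerA.
by rewrite mulrC.
Qed.

Lemma char_t_order i : char_t i ^+ r = 1.
Proof.
apply: (eq_on_e relH) => l; rewrite (eigenX _ (eigen_char_t i l)) mulnC exprM (zX hr hz).
by rewrite expr1n scale1r mul1r.
Qed.

Lemma vl_lt l j : (vl l j < r)%N.
Proof. by rewrite /vl; case: insub => [p|]. Qed.

Lemma Y_to_H_rel : Yrel r n q qi ri Y_to_H.
Proof.
split; first by move=> i j i0 ij jn; apply: relH.1.
split; first by move=> i i0 jn; apply: relH.2.1.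
split; first by move=> i j _ _; apply: char_t_comm.
split.
  move=> i j hi hj; have hi' : (0 < i < n)%N by lia.
  apply: (eq_on_e relH) => l; rewrite -[LHS]mulrA -[RHS]mulrA /= eigen_char_t.
  rewrite (g_e relH) // mulrA eigen_char_t -scalerAr -scalerAl (g_e relH) //.
  by rewrite vl_swl ?swK // sw_range.
split; first by move=> i _; apply: char_t_order.
split.
  move=> i hi; have hi' : (0 < i < n)%N by lia.
  apply: (eq_on_e relH) => l; rewrite expr2 /= (gg_e relH) // [RHS]mulrDl mul1r -[in RHS]scalerAl.
  rewrite -[in RHS]mulrA (g_e relH) // (mulrA (_ *: _)).
  rewrite (eigen_e hr hri hz (vl_lt _ _) (vl_lt _ _) (eigen_char_t i _) (eigen_char_t i.+1 _)).
  by rewrite vl_swl_l // vl_swl_r // eq_sym -scalerAl !scalerA.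
split; first exact: (XK relH).
split; first exact: relH.2.2.2.2.2.2.2.1.
split; first exact: relH.2.2.2.2.2.2.2.2.1.
move=> j hj; apply: (eq_on_e relH) => l; rewrite -[LHS]mulrA -[RHS]mulrA /= eigen_char_t.
by rewrite (X_e relH) mulrA eigen_char_t -scalerAl -scalerAr (X_e relH).
Qed.

Local Notation t i := (genY (Yt i)).
Local Notation h i := (genY (Yh i)).
Local Notation tf := (fun i => genY (Yt i)).
Let relY := HY.1.

Lemma Y_tC i j : (0 < i <= n)%N -> (0 < j <= n)%N -> t i * t j = t j * t i.
Proof. exact: relY.2.2.1. Qed.

Lemma Y_tr i : (0 < i <= n)%N -> t i ^+ r = 1.
Proof. exact: relY.2.2.2.2.1. Qed.

Lemma Y_ht i j : (0 < i < n)%N -> (0 < j <= n)%N -> h i * t j = t (sw i j) * h i.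
Proof. by move=> hi; apply: relY.2.2.2.1; lia. Qed.

Local Notation E l := (weight_idem z ri tf l).

Lemma eigen_weight_idem j l : (0 < j <= n)%N -> t j * E l = z ^+ vl l j *: E l.
Proof.
move=> hj; have hj' : (j.-1 < n)%N by lia.
have := @weight_vector_weight_idem n r hr R z ri hz Y tf Y_tC Y_tr l (Ordinal hj').
by rewrite /eigen -vl_ord /= prednK //; lia.
Qed.

Lemma hE i l : (0 < i < n)%N -> h i * E l = E (swl i l) * h i.
Proof.
move=> hi; apply: (weight_idem_intertwine hr hri hz); first exact: (can_inj (fun x => swlK x hi)).
move=> m p; have hp : (0 < p.+1 <= n)%N := ltn_ord p.
have hs := sw_range hi hp.
rewrite /eigen -vl_ord vl_swl // mulrA -[in t p.+1](swK i p.+1) -Y_ht //.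
by rewrite -mulrA eigen_weight_idem // scalerAr.
Qed.

Lemma Y1_weight_idem l : genY YY * E l = E l * genY YY.
Proof.
apply: (weight_idem_intertwine (f := id) hr hri hz) => // m p.
have hp : (0 < p.+1 <= n)%N := ltn_ord p.
have /= c := relY.2.2.2.2.2.2.2.2.2 p.+1 hp.
by rewrite /eigen -vl_ord mulrA c -mulrA eigen_weight_idem // scalerAr.
Qed.

Definition H_to_Y (x : HG n r) : Y :=
  match x with Hg i => h i | He l => E l | HX => genY YY | HXi => genY YYi end.

Lemma H_to_Y_rel : Hrel q qi H_to_Y.
Proof.
split; first by move=> i j i0 ij jn; apply: relY.1.
split; first by move=> i i0 jn; apply: relY.2.1.
split; first by move=> i l hi; apply: hE; lia.
split; first exact: (sum_weight_idem n hr hri hz).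
split; first by move=> l m; apply: (weight_idemM hr hri hz Y_tC Y_tr).
split.
  move=> i hi; have hi' : (0 < i < n)%N by lia.
  rewrite [LHS](relY.2.2.2.2.2.1 i hi); congr (_ + _ *: _).
  (* Inserting the sum of the projections turns e_i into the sum of those with equal entries at i
     and i+1. *)
  rewrite -[X in _ * X = _]mul1r -(sum_weight_idem n hr hri hz tf) mulr_suml mulr_sumr [in RHS]big_mkcond.
  apply: eq_bigr => l _; rewrite mulrA.
  have ei : eigen z tf i (vl l i) (E l) by apply: eigen_weight_idem; lia.
  have ej : eigen z tf i.+1 (vl l i.+1) (E l) by apply: eigen_weight_idem; lia.
  rewrite (eigen_e hr hri hz (vl_lt _ _) (vl_lt _ _) ei ej) -swl_fix //.
  case: eqP => fl; last by rewrite scale0r mul0r.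
  by rewrite scale1r /= hE // fl.
split; first exact: relY.2.2.2.2.2.2.1.
split; first exact: relY.2.2.2.2.2.2.2.1.
split; first exact: relY.2.2.2.2.2.2.2.2.1.
exact: Y1_weight_idem.
Qed.

Lemma Y_iso_H : exists (al : {lrmorphism Y -> H}) (be : {lrmorphism H -> Y}),
  cancel al be /\ cancel be al.
Proof.
have [[al alE] _] := HY.2 H Y_to_H Y_to_H_rel.
have [[be beE] _] := HH.2 Y H_to_Y H_to_Y_rel.
exists al, be; split=> x.
  have [_ /(_ (be \o al : {lrmorphism Y -> Y}) (idfun : {lrmorphism Y -> Y}))] := HY.2 Y genY HY.1.
  move=> /(_ _ x)/= -> //; case=> [j hj|i hi||] /=; rewrite alE //= ?beE //.
  rewrite raddf_sum -[RHS]mulr1 -(sum_weight_idem n hr hri hz tf) mulr_sumr.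
  by apply: eq_bigr => l _; rewrite /= linearZ_LR /= beE //= eigen_weight_idem.
have [_ /(_ (al \o be : {lrmorphism H -> H}) (idfun : {lrmorphism H -> H}))] := HH.2 H genH HH.1.
move=> /(_ _ x)/= -> //; case=> [i hi|l _||] /=; rewrite beE //= ?alE //.
have -> : al (E l) = weight_idem z ri char_t l.
  rewrite /weight_idem rmorph_prod; apply: eq_bigr => p _ /=.
  rewrite /char_idem linearZ_LR raddf_sum; congr (_ *: _); apply: eq_bigr => s _.
  by rewrite /= linearZ_LR /= rmorphXn /= alE //= ltn_ord.
apply: (eq_on_e relH) => m.
have wm : weight_vector z char_t m (e m) by move=> p; rewrite -vl_ord; apply: eigen_char_t.
rewrite (weight_idem_eigen hr hri hz l wm) (e_orthogonal relH).
by case: eqP => [->|]; rewrite ?scale1r ?scale0r.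
Qed.

End YokonumaHecke.

(** * The isomorphisms *)

Section MatrixIsomorphisms.
Variables (n r : nat) (l0 : Lam n r) (R : comNzRingType) (q qi : R).
Variables (H : algType R) (genH : HG n r -> H).
Hypothesis relH : Hrel q qi genH.
Variables (A : algType R) (genA : AG -> A).
Variables (rho : {lrmorphism H -> ffmx A l0}) (theta : {lrmorphism A -> H}).
Local Notation e := (fun l : Lam n r => genH (He l)).
Local Notation gamma := (gamma genH).
Local Notation gamma' := (gamma' genH).
Hypothesis block : forall x, blockwise genH genA rho theta x.
Hypothesis theta_stab : forall (l : Lam n r) h, dominant l -> in_Hlam genA l h ->
  theta h * e l = e l * (theta h * e l).
Hypothesis rho_e : forall (l m k : Lam n r) x,
  rho (x * e l) (m, k) = if k == l then rho x (m, k) else 0.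
Hypothesis rho_theta : forall (l : Lam n r) h, dominant l -> in_Hlam genA l h ->
  rho (theta h * e l) (l, l) = h.
Implicit Types (l m k : Lam n r).

Lemma e_orth l m x : l \notin orbW m -> e l * x * e m = 0.
Proof.
by move=> lm; have [_ h ->] := block x l m; rewrite h // rmorph0 mulr0 mul0r.
Qed.

Lemma orbW_symE l m : (l \in orbW m) = (m \in orbW l).
Proof. by apply/idP/idP; apply: orbW_sym. Qed.

Lemma gamma_orth l m : l != m -> gamma' l * gamma m = 0.
Proof.
move=> lm; rewrite -(gamma'_e relH l) -(e_gamma relH m) !mulrA -(mulrA (gamma' l)).
by rewrite (e_orthogonal relH) (negPf lm) mulr0 mul0r.
Qed.

Lemma gamma'_orth l m x : l \notin orbW m -> gamma' l * x * e m = 0.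
Proof.
by move=> lm; rewrite -(gamma'_e relH l) -!mulrA (mulrA (e l)) e_orth // mulr0.
Qed.

Section E.
Variables (Y : algType R) (al : {lrmorphism Y -> H}) (be : H -> Y).
Hypotheses (alK : cancel al be) (beK : cancel be al).

(** The transport elements move the block (l, m) into the corner between the dominant
    representatives, as the entries of E require. *)
Definition phi (y : Y) : {ffun Lam n r * Lam n r -> H} :=
  [ffun p => if p.2 \in orbW p.1 then gamma' p.1 * al y * gamma p.2 else 0].

Lemma phiE y l m : phi y (l, m) = if m \in orbW l then gamma' l * al y * gamma m else 0.
Proof. by rewrite ffunE. Qed.

Lemma phi_in y : Eset e (phi y).
Proof.
move=> l m; rewrite phiE; split=> [/negPf->//|lm].
exists (gamma' l * al y * gamma m); rewrite lm.
by rewrite !mulrA (e_gamma' relH) -!mulrA (gamma_e relH).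
Qed.

Lemma phi_inj y1 y2 : phi y1 = phi y2 -> y1 = y2.
Proof.
move=> eq; apply: (can_inj alK); apply: (eq_on_e relH) => m.
rewrite -[LHS]mul1r -[RHS]mul1r -(sum_e relH) !mulr_suml; apply: eq_bigr => l _.
rewrite !mulrA; case: (boolP (l \in orbW m)) => lm; last by rewrite !e_orth.
have := congr1 (fun f : {ffun _} => gamma l * f (l, m) * gamma' m) eq.
rewrite /= !phiE orbW_symE lm !mulrA (gammaK relH l).1.
by rewrite -!(mulrA _ (gamma m)) (gammaK relH m).1.
Qed.

Lemma phi_surj x : Eset e x -> exists y, phi y = x.
Proof.
move=> hx; exists (be (\sum_l \sum_m gamma l * x (l, m) * gamma' m)).
apply/ffunP=> -[l m]; rewrite phiE beK; have [x0 xh] := hx l m.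
case: (boolP (m \in orbW l)) => lm; last by rewrite x0.
rewrite mulr_sumr mulr_suml (bigD1 l) //= [X in _ + X]big1 ?addr0 => [|k kl]; last first.
  rewrite mulr_sumr mulr_suml big1 // => p _.
  by rewrite !mulrA gamma_orth ?mul0r // eq_sym.
rewrite mulr_sumr mulr_suml (bigD1 m) //= big1 ?addr0 => [|p pm]; last first.
  by rewrite -!mulrA gamma_orth ?mulr0.
have [h ->] := xh lm.
rewrite !mulrA (gammaK relH l).2 (e_idem relH) -!mulrA (gammaK relH m).2.
by rewrite (e_idem relH).
Qed.

Lemma phi_linear (a : R) y1 y2 : phi (a *: y1 + y2) = Elin a (phi y1) (phi y2).
Proof.
apply/ffunP=> -[l m]; rewrite /Elin [RHS]ffunE !phiE; case: ifP => _; last by rewrite scaler0 addr0.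
by rewrite linearP mulrDr mulrDl -scalerAr -scalerAl.
Qed.

Lemma phiM y1 y2 : phi (y1 * y2) = Emul (phi y1) (phi y2).
Proof.
apply/ffunP=> -[l m]; rewrite /Emul [RHS]ffunE phiE /=.
case: (boolP (m \in orbW l)) => lm; last first.
  rewrite big1 // => k kl; rewrite !phiE [X in _ * X]ifF ?mulr0 //.
  by apply: contraNF lm => mk; apply: orbW_trans kl mk.
rewrite rmorphM -[al y1 * _]mulr1 mulr1 -[X in X * al y2]mulr1 -(sum_e relH).
rewrite !mulr_sumr !mulr_suml mulr_sumr mulr_suml [RHS]big_mkcond; apply: eq_bigr => k _.
rewrite !mulrA; case: (boolP (k \in orbW l)) => kl; last first.
  by rewrite gamma'_orth ?mul0r // orbW_symE.
rewrite !phiE kl (orbW_trans (orbW_sym kl) lm) -(gammaK relH k).1.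
by rewrite !mulrA.
Qed.

Lemma phi1 : phi 1 = Eone e.
Proof.
apply/ffunP=> -[l m]; rewrite /Eone [RHS]ffunE phiE /= rmorph1 mulr1.
case: eqP => [<-|/eqP lm]; first by rewrite orbW_refl (gammaK relH l).2.
by rewrite gamma_orth // if_same.
Qed.

End E.

(** Indices within one orbit share the representative l, so each entry lies in the corner at l,
    where the coefficient (l, l) of [rho] identifies it with an element of H_l. *)
Definition psi (x : {ffun Lam n r * Lam n r -> H}) : DS n r A := fun l =>
  if dominant l then \matrix_(i, j) rho (x (enum_val i, enum_val j)) (l, l) else 0.

Lemma lam0_enum l (i : 'I_#|orbW l|) : dominant l -> lam0 (enum_val i) = l.
Proof. by move=> dl; rewrite (lam0_orb (enum_valP i)) lam0_id. Qed.

Lemma DS_ext (M N : DS n r A) : (forall l, M l = N l) -> M = N.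
Proof. exact: boolp.functional_extensionality_dep. Qed.

Lemma psi_in x : Eset e x -> DSset genA (psi x).
Proof.
move=> hx l; rewrite /psi; case dl: (dominant l) => // i j; rewrite mxE.
by have [] := block (x (enum_val i, enum_val j)) l l; rewrite lam0_id.
Qed.

Lemma corner_inj l (u v : H) : dominant l -> rho (e l * u * e l) (l, l) = rho (e l * v * e l) (l, l) ->
  e l * u * e l = e l * v * e l.
Proof.
move=> dl eq; have c w : e l * (e l * w * e l) * e l = e l * w * e l.
  by rewrite !mulrA (e_idem relH) -mulrA (e_idem relH).
rewrite -[LHS]c -[RHS]c.
by have [_ _ ->] := block (e l * u * e l) l l; have [_ _ ->] := block (e l * v * e l) l l; rewrite eq.
Qed.

Lemma psi_inj x1 x2 : Eset e x1 -> Eset e x2 -> psi x1 = psi x2 -> x1 = x2.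
Proof.
move=> h1 h2 eq; apply/ffunP=> -[l m].
have [z1 c1] := h1 l m; have [z2 c2] := h2 l m.
case: (boolP (m \in orbW l)) => lm; last by rewrite z1 // z2.
have [dl ol] := lam0P l; have ol' := orbW_sym ol; have om := orbW_trans ol' lm.
have := congr1 (fun M : DS n r A => M (lam0 l) (enum_rank_in ol' l) (enum_rank_in ol' m)) eq.
rewrite /psi dl !mxE !enum_rankK_in //.
have [u ->] := c1 lm; have [v ->] := c2 lm; rewrite (lam0_orb lm).
exact: corner_inj.
Qed.

Definition DS_entry (M : DS n r A) k l m : A :=
  M k (enum_rank_in (orbW_refl k) l) (enum_rank_in (orbW_refl k) m).

Lemma psi_surj M : DSset genA M -> exists x, Eset e x /\ psi x = M.
Proof.
move=> hM.
have hE k l m : dominant k -> in_Hlam genA k (DS_entry M k l m).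
  by move=> dk; have := hM k; rewrite dk; apply.
(* [theta] cut by the idempotent lifts each matrix entry back to the corner. *)
exists [ffun p => if p.2 \in orbW p.1
   then theta (DS_entry M (lam0 p.1) p.1 p.2) * e (lam0 p.1) else 0].
split=> [l m|].
  rewrite ffunE /=; split=> [/negPf->//|lm]; rewrite lm.
  have [dl _] := lam0P l; exists (theta (DS_entry M (lam0 l) l m)).
  by rewrite (lam0_orb lm) -mulrA -theta_stab //; apply: hE.
apply: DS_ext => l; have := hM l; rewrite /psi; case dl: (dominant l) => hl; last by rewrite hl.
apply/matrixP=> i j; rewrite mxE ffunE /=.
rewrite mem_orbW !lam0_enum // eqxx rho_theta //; last exact: hE.
by rewrite /DS_entry !enum_valK_in.
Qed.

Lemma psi_linear (a : R) x1 x2 : psi (Elin a x1 x2) = DSlin a (psi x1) (psi x2).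
Proof.
apply: DS_ext => l; rewrite /psi /DSlin; case: ifP => dl; apply/matrixP=> i j; rewrite !mxE.
  by rewrite ffunE linearP ffunE ffmxZ.
by rewrite scaler0 addr0.
Qed.

Lemma psiM x1 x2 : Eset e x1 -> psi (Emul x1 x2) = DSmul (psi x1) (psi x2).
Proof.
move=> h1; apply: DS_ext => l; rewrite /psi /DSmul; case: ifP => dl; last by rewrite mul0mx.
apply/matrixP=> i j; rewrite !mxE ffunE /= raddf_sum sum_ffunE.
rewrite (eq_bigl (fun m => m \in orbW l)) => [|m]; last by rewrite !mem_orbW (lam0_enum i dl) (lam0_id dl).
rewrite (big_enum_val (fun m => rho (x1 (enum_val i, m) * x2 (m, enum_val j)) (l, l))) /=.
apply: eq_bigr => k _; rewrite !mxE rmorphM ffmxM.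
have [_ c] := h1 (enum_val i) (enum_val k).
have [|u ->] := c; first by rewrite mem_orbW !lam0_enum.
(* The left factor ends in [e l], so only the column l of its matrix contributes. *)
rewrite !lam0_enum // (bigD1 l) //= big1 ?addr0 // => m ml.
by rewrite rho_e (negPf ml) mul0r.
Qed.

Lemma psi1 : psi (Eone e) = DSone (n:=n) (r:=r) A.
Proof.
apply: DS_ext => l; rewrite /psi /DSone; case: ifP => dl //; apply/matrixP=> i j.
rewrite !mxE ffunE /= (inj_eq enum_val_inj) lam0_enum //; case: eqP => _.
  by rewrite -[genH _]mul1r rho_e eqxx rmorph1 ffmx1 eqxx.
by rewrite rmorph0 ffunE.
Qed.

End MatrixIsomorphisms.

Theorem theorem5p2 (r n : nat) (hr : (0 < r)%N) (hn : (0 < n)%N)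
  (R : comNzRingType) (q qi z ri : R) (HR : is_base_ring r q qi z ri)
  (Y : algType R) (genY : YG -> Y)
  (HY : presents (Yvalid n) (Yrel r n q qi ri) genY)
  (H : algType R) (genH : HG n r -> H)
  (HH : presents (@Hvalid n r) (Hrel q qi) genH)
  (Hn : algType R) (genA : AG -> Hn)
  (HA : presents (Avalid n) (Arel n q qi) genA) :
  let e := fun l : Lam n r => genH (He l) in
  (* \hat Y_{r,n} ~= \hat E_{r,n}^R  (R-algebra isomorphism phi) *)
  (exists phi : Y -> {ffun Lam n r * Lam n r -> H},
     (forall y, Eset e (phi y)) /\
     (forall y1 y2, phi y1 = phi y2 -> y1 = y2) /\
     (forall x, Eset e x -> exists y, phi y = x) /\
     (forall (a : R) y1 y2, phi (a *: y1 + y2) = Elin a (phi y1) (phi y2)) /\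
     (forall y1 y2, phi (y1 * y2) = Emul (phi y1) (phi y2)) /\
     phi 1 = Eone e) /\
  (* \hat E_{r,n}^R ~= (+)_{lambda in s'_n} Mat_{n_lambda}(\hat H_lambda^R) *)
  (exists psi : {ffun Lam n r * Lam n r -> H} -> DS n r Hn,
     (forall x, Eset e x -> DSset genA (psi x)) /\
     (forall x1 x2, Eset e x1 -> Eset e x2 -> psi x1 = psi x2 -> x1 = x2) /\
     (forall M, DSset genA M -> exists x, Eset e x /\ psi x = M) /\
     (forall (a : R) x1 x2, Eset e x1 -> Eset e x2 ->
        psi (Elin a x1 x2) = DSlin a (psi x1) (psi x2)) /\
     (forall x1 x2, Eset e x1 -> Eset e x2 ->
        psi (Emul x1 x2) = DSmul (psi x1) (psi x2)) /\
     psi (Eone e) = DSone (n:=n) (r:=r) Hn).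
Proof.
have [[_ hri hz] _] := HR; move=> e.
have [relH relA] := (HH.1, HA.1).
(* A witness that the index set of the matrices is nonempty, available because r is positive. *)
pose l0 : Lam n r := [ffun=> Ordinal hr].
have [[rho rhoE] _] := HH.2 _ _ (model_rel hn l0 relA).
have [th [th_rel thE]] := theta_exists relH hn.
have [[theta thetaE] _] := HA.2 _ _ th_rel.
have [al [be [alK beK]]] := Y_iso_H hr hn hri hz HY HH.
have thetaT (l : Lam n r) i : dominant l -> (0 < i < n)%N -> vl l i = vl l i.+1 ->
    theta (genA (AT i)) * e l = genH (Hg n r i) * e l.
  by move=> dl hi eq; rewrite thetaE /=; [apply: (thE l dl).1|lia].
have thetaZ (l : Lam n r) j : dominant l -> (0 < j <= n)%N ->
    theta (genA (AZ j)) * e l = jm (fun i => genH (Hg n r i)) (genH (HX n r)) j * e l /\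
    theta (genA (AZi j)) * e l = jm (ginv q qi genH) (genH (HXi n r)) j * e l.
  by move=> dl hj; rewrite !thetaE //; apply: (thE l dl).2.
have block := all_blockwise hn HH rhoE thetaT thetaZ.
have stab := theta_stab hn HH thetaT thetaZ.
have rhoe := rho_e rhoE.
have rhot := rho_theta hn HH relA rhoE thetaT thetaZ.
split.
  exists (phi genH al); split; first exact: (phi_in relH al).
  split; first exact: (phi_inj relH block alK).
  split; first exact: (phi_surj relH beK).
  split; first exact: phi_linear.
  by split; [exact: (phiM relH block al)|exact: (phi1 relH al)].
exists (psi rho); split; first exact: (psi_in block).
split; first exact: (psi_inj relH block).
split; first exact: (psi_surj stab rhot).
split; first by move=> a x1 x2 _ _; apply: psi_linear.
split; first by move=> x1 x2 h1 _; apply: (psiM rhoe).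
exact: (psi1 rhoe).
Qed.
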